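(* Let $G$ be a discrete group, and let $H<K<G$ be a triple of groups (i.e. $H$ is a subgroup of $K$ and $K$ is a subgroup of $G$). Let $B=L(H)\subset N=L(K)\subset M=L(G)$ be the associated group von Neumann algebras. Then the following conditions are equivalent: \begin{enumerate} \item[(1)] There exists a net $(h_i)_{i\in I}\subset H$ such that, for all $x,y\in M\ominus N$, one has $\lim_{i\in I}\Vert \mathbb{E}_B(x\lambda_{h_i}y)\Vert_2=0$ (i.e. the net of unitaries in the relative weak asymptotic homomorphism property may be chosen in the subgroup $\lambda(H)$ of $U(B)$). \item[(2)] The triple $B\subset N\subset M$ has the relative weak asymptotic homomorphism property. \item[(3)] If $g\in G$ and a finite set $F\subset G$ are such that $Hg\subset FH$, then $g\in K$; i.e. $q\mathcal{N}_G^{(1)}(H)\subset K$. \item[(4)] The subspace of $H$-compact vectors $\ell^2(G/H)_{c,H}$ is contained in $\ell^2(K/H)$. \item[(5)] The subspace $\ell^2(G/H)^H$ of $H$-invariant vectors is contained in $\ell^2(K/H)$. \item[(6)] For every non-empty finite set $F\subset G\setminus K$, there exists $h\in H$ such that $FhF\cap H=\emptyset$. \end{enumerate}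
   Context: For $g\in G$, $\lambda_g$ is the unitary operator on $\ell^2(G)$ given by left translation, $(\lambda_g\xi)(g')=\xi(g^{-1}g')$. $L(G)$ is the von Neumann algebra on $\ell^2(G)$ generated by $\lambda(G)=\{\lambda_g : g\in G\}$; for a subgroup $S<G$, $L(S)$ is identified with the von Neumann subalgebra of $L(G)$ generated by $\{\lambda_s : s\in S\}$. $M=L(G)$ carries its canonical normal faithful normalized trace $\tau(x)=\langle x\delta_e,\delta_e\rangle$, and $\Vert x\Vert_2=\tau(x^*x)^{1/2}$. $\mathbb{E}_N$ (resp. $\mathbb{E}_B$) denotes the $\tau$-preserving conditional expectation from $M$ onto $N$ (resp. $B$), and $M\ominus N=\{x\in M:\mathbb{E}_N(x)=0\}$. $U(B)$ is the unitary group of $B$. Relative weak asymptotic homomorphism property: a triple $1\in B\subset N\subset M$ of finite von Neumann algebras with a fixed normal, finite, faithful, normalized trace $\tau$ on $M$ has this property if there exists a net of unitaries $(u_i)_{i\in I}\subset U(B)$ such that, for all $x,y\in M\ominus N$, $\lim_{i\in I}\Vert\mathbb{E}_B(xu_iy)\Vert_2=0$. One sided quasi-normalizer of $H$ in $G$: $q\mathcal{N}_G^{(1)}(H)$ is the set of all $g\in G$ for which there exist finitely many elements $g_1,\ldots,g_n\in G$ such that $Hg\subset\bigcup_{i=1}^n g_iH$. Quasi-regular representation: $G/H$ is the set of left cosets $[g]=gH$, and $\pi$ is the unitary representation of $G$ on $\ell^2(G/H)$ given by $(\pi(g)\xi)([g'])=\xi([g^{-1}g'])$. A vector $\xi\in\ell^2(G/H)$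 is $H$-compact if the norm closure of its orbit $\{\pi(h)\xi:h\in H\}$ is a compact subset of $\ell^2(G/H)$; the set of all $H$-compact vectors is a closed subspace denoted $\ell^2(G/H)_{c,H}$. Also $\ell^2(G/H)^H=\{\xi\in\ell^2(G/H):\pi(h)\xi=\xi\ \forall h\in H\}$. The space $\ell^2(K/H)$ is regarded as the subspace of $\ell^2(G/H)$ of vectors supported in $K/H\subset G/H$. For subsets $A,C\subset G$ and $h\in G$, $AC=\{ac:a\in A,c\in C\}$ and $AhC=\{ahc:a\in A,c\in C\}$. *)

(* Defs.v *)
From HB Require Import structures.
From mathcomp Require Import all_boot all_order all_algebra.
From mathcomp Require Import complex.
From mathcomp Require Import all_classical all_reals all_analysis.
From mathcomp Require summability.
From mathcomp Require Import ring lra.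

Set Implicit Arguments.
Unset Strict Implicit.
Unset Printing Implicit Defensive.

Import Order.TTheory GRing.Theory Num.Theory.
Import numFieldNormedType.Exports.

Local Open Scope classical_set_scope.
Local Open Scope ring_scope.

Section SquareSum.
Variables (R : realType) (X : choiceType).
Implicit Types f g : X -> R[i]^o.

Definition sqsum f : \bar R :=
  \esum_(x in [set: X]) (Normc.normc (f x) ^+ 2)%:E.

Lemma normc_ge0 (z : R[i]) : 0 <= Normc.normc z.
Proof. by case: z => a b; exact: sqrtr_ge0. Qed.

Lemma sqsum_ge0 f : (0 <= sqsum f)%E.
Proof. by apply: esum_ge0 => x _; rewrite lee_fin sqr_ge0. Qed.

Lemma sqsum_fineK f : (sqsum f < +oo)%E -> (fine (sqsum f))%:E = sqsum f.
Proof. by move=> foo; rewrite fineK// ge0_fin_numE ?sqsum_ge0. Qed.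

Lemma sqsum_eq0 f : sqsum f = 0%E -> f = 0.
Proof.
move=> f0; apply/funext => x; apply: Normc.eq0_normc.
apply/eqP; rewrite -sqrf_eq0 eq_le sqr_ge0 andbT -lee_fin.
move: f0 => /eqP; rewrite eq_le => /andP[f0 _]; apply: le_trans f0.
apply: esum_ge; exists [set x]; first by split => //; exact: finite_set1.
by rewrite fsbig_set1.
Qed.

Lemma sqsum0 : sqsum 0 = 0%E.
Proof. by apply: esum1 => x _; rewrite Normc.normc0 expr0n. Qed.

Lemma le_esumZ (k : R) (a : X -> R) : 0 <= k -> (forall x, 0 <= a x) ->
  (\esum_(x in [set: X]) (k * a x)%:E <=
   k%:E * \esum_(x in [set: X]) (a x)%:E)%E.
Proof.
move=> k0 a0; apply: ge_ereal_sup => _ [F FX <-].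
under eq_fsbigr do rewrite EFinM.
rewrite -ge0_mule_fsumr//; apply: lee_wpmul2l => //.
by apply: esum_ge; exists F.
Qed.

Lemma le_sqsumZ (a : R[i]) f :
  (sqsum (a *: f) <= (Normc.normc a ^+ 2)%:E * sqsum f)%E.
Proof.
apply: le_trans (le_esumZ _ _); rewrite ?sqr_ge0//; last first.
  by move=> x; exact: sqr_ge0.
by apply: le_esum => x _; rewrite lee_fin Normc.normcM exprMn.
Qed.

Lemma sqsumZ (a : R[i]) f :
  sqsum (a *: f) = ((Normc.normc a ^+ 2)%:E * sqsum f)%E.
Proof.
have [->|a0] := eqVneq a 0.
  by rewrite scale0r sqsum0 Normc.normc0 expr0n mul0e.
have na0 : Normc.normc a != 0.
  by apply: contra_neq a0 => /Normc.eq0_normc.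
have nag0 : 0 < Normc.normc a ^+ 2 by rewrite exprn_gt0// lt0r na0 normc_ge0.
apply/eqP; rewrite eq_le le_sqsumZ /=.
rewrite muleC -lee_pdivlMr// muleC -{1}(scalerK a0 f).
apply: le_trans (le_sqsumZ _ _) _.
by rewrite Normc.normcV exprVn.
Qed.

(* [k = B / A] turns this into Minkowski's inequality for norms A and B *)
Lemma sqsumD_le (k : R) f g : 0 < k ->
  (sqsum (f + g)%R <= (1 + k)%:E * sqsum f + (1 + k^-1)%:E * sqsum g)%E.
Proof.
move=> k0; have k0' : 0 < k^-1 by rewrite invr_gt0.
have sq0 (h : X -> R[i]^o) x : 0 <= Normc.normc (h x) ^+ 2 by exact: sqr_ge0.
have k1 : 0 <= 1 + k by rewrite addr_ge0// ltW.
have k1' : 0 <= 1 + k^-1 by rewrite addr_ge0// ltW.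
apply: (@le_trans _ _
  (\esum_(x in [set: X]) ((1 + k) * Normc.normc (f x) ^+ 2)%:E +
   \esum_(x in [set: X]) ((1 + k^-1) * Normc.normc (g x) ^+ 2)%:E)%E); last first.
  by apply: leeD; exact: le_esumZ.
rewrite -esumD; last 2 first.
- by move=> x _; rewrite lee_fin mulr_ge0.
- by move=> x _; rewrite lee_fin mulr_ge0.
apply: le_esum => x _; rewrite -EFinD lee_fin.
set a := Normc.normc (f x); set b := Normc.normc (g x).
apply: (@le_trans _ _ ((a + b) ^+ 2)).
  rewrite ler_pXn2r ?nnegrE ?addr_ge0 ?normc_ge0//; exact: le_normcD.
rewrite -subr_ge0.
have -> : (1 + k) * a ^+ 2 + (1 + k^-1) * b ^+ 2 - (a + b) ^+ 2 =
    k * (a - k^-1 * b) ^+ 2.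
  by field; rewrite gt_eqF.
by rewrite mulr_ge0 ?sqr_ge0// ltW.
Qed.

Lemma sqsumD_lty f g :
  (sqsum f < +oo)%E -> (sqsum g < +oo)%E -> (sqsum (f + g)%R < +oo)%E.
Proof.
move=> foo goo; apply: le_lt_trans (sqsumD_le f g ltr01) _.
by rewrite -(sqsum_fineK foo) -(sqsum_fineK goo) -!EFinM -EFinD ltry.
Qed.

Lemma sqsumZ_lty (a : R[i]) f : (sqsum f < +oo)%E -> (sqsum (a *: f) < +oo)%E.
Proof. by move=> foo; rewrite sqsumZ -(sqsum_fineK foo) -EFinM ltry. Qed.

Lemma sqsum_inj f (s : X -> X) : injective s ->
  (sqsum f < +oo)%E -> (sqsum (f \o s) < +oo)%E.
Proof.
move=> sI; apply: le_lt_trans.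
rewrite /sqsum /= -(@esum_image _ _ _ [set: X] s
  (fun x => (Normc.normc (f x) ^+ 2)%:E)); last by move=> x y _ _; exact: sI.
rewrite esum_mkcond; apply: le_esum => x _.
by case: ifPn => // _; rewrite lee_fin sqr_ge0.
Qed.

End SquareSum.

Section Ell2.
Variables (R : realType) (X : choiceType).

Definition sqsummable : {pred (X -> R[i]^o)} := fun f => (sqsum f < +oo)%E.

Fact sqsummable_submod : GRing.submod_closed sqsummable.
Proof.
split=> [|a f g foo goo]; rewrite unfold_in; first by rewrite sqsum0 ltry.
by apply: sqsumD_lty => //; exact: sqsumZ_lty.
Qed.

HB.instance Definition _ :=
  GRing.isSubmodClosed.Build R[i] (X -> R[i]^o) sqsummable sqsummable_submod.

Record ell2 := Ell2 { ell2_fun :> X -> R[i]^o ; _ : ell2_fun \in sqsummable }.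

HB.instance Definition _ := [isSub for ell2_fun].
HB.instance Definition _ := [Choice of ell2 by <:].
HB.instance Definition _ := [SubChoice_isSubLmodule of ell2 by <:].

Lemma ell2P (f : ell2) : (sqsum f < +oo)%E.
Proof. exact: (valP f). Qed.

Definition ell2_norm (f : ell2) : R := Num.sqrt (fine (sqsum f)).

Lemma ell2_norm_ge0 f : 0 <= ell2_norm f.
Proof. exact: sqrtr_ge0. Qed.

Lemma sqr_ell2_norm (f : ell2) : ((ell2_norm f) ^+ 2)%:E = sqsum f.
Proof. by rewrite sqr_sqrtr ?fine_ge0 ?sqsum_ge0// sqsum_fineK ?ell2P. Qed.

Lemma ell2_norm_eq0 f : ell2_norm f = 0 -> f = 0.
Proof.
move=> f0; apply/val_inj/sqsum_eq0.
by rewrite -sqr_ell2_norm f0 expr0n.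
Qed.

Lemma ell2_normZ (a : R[i]) f : ell2_norm (a *: f) = Normc.normc a * ell2_norm f.
Proof.
apply/eqP; rewrite -(@eqrXn2 _ 2)// ?mulr_ge0 ?normc_ge0 ?ell2_norm_ge0//.
apply/eqP/EFin_inj; rewrite sqr_ell2_norm.
by rewrite exprMn [RHS]EFinM sqr_ell2_norm -sqsumZ.
Qed.

Lemma ler_ell2_normD f g : ell2_norm (f + g) <= ell2_norm f + ell2_norm g.
Proof.
have [/ell2_norm_eq0 ->|f0] := eqVneq (ell2_norm f) 0.
  by rewrite add0r lerDr ell2_norm_ge0.
have [/ell2_norm_eq0 ->|g0] := eqVneq (ell2_norm g) 0.
  by rewrite addr0 lerDl ell2_norm_ge0.
have {}f0 : 0 < ell2_norm f by rewrite lt0r f0 ell2_norm_ge0.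
have {}g0 : 0 < ell2_norm g by rewrite lt0r g0 ell2_norm_ge0.
rewrite -(@ler_pXn2r _ 2) ?nnegrE ?addr_ge0 ?ell2_norm_ge0//.
rewrite -lee_fin sqr_ell2_norm.
apply: le_trans (sqsumD_le f g (divr_gt0 g0 f0)) _.
rewrite -!sqr_ell2_norm -!EFinM -EFinD lee_fin invf_div.
rewrite le_eqVlt; apply/orP; left; apply/eqP.
by field; rewrite !gt_eqF.
Qed.

Let norm (f : ell2) : R[i] := (ell2_norm f)%:C%C.

Let ler_normD f g : norm (f + g) <= norm f + norm g.
Proof. by rewrite -rmorphD/= lecR ler_ell2_normD. Qed.

Let normrZ (a : R[i]) f : norm (a *: f) = `|a| * norm f.
Proof. by rewrite /norm ell2_normZ rmorphM; case: a. Qed.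

Let normr0_eq0 f : norm f = 0 -> f = 0.
Proof. by move=> [] /ell2_norm_eq0. Qed.

HB.instance Definition _ :=
  Lmodule_isNormed.Build R[i] ell2 ler_normD normrZ normr0_eq0.

(* The sum is the limit of the finite partial sums along the filter of finite
   subsets of [X]; [inner] is linear in its first argument. *)
Definition inner (f g : ell2) : R[i] :=
  @summability.sum X R[i] R[i]^o (fun x => f x * (g x : R[i])^*).

Fact delta_subproof (x : X) :
  (fun y => (y == x)%:R : R[i]^o) \in sqsummable.
Proof.
rewrite unfold_in /sqsum (esumID [set x])/=; last first.
  by move=> y _; rewrite lee_fin sqr_ge0.
rewrite setTI esum_set1 ?lee_fin ?sqr_ge0// esum1 ?adde0 ?ltry//.
move=> y [_ /= /eqP/negbTE ->].
by rewrite Normc.normc0 expr0n.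
Qed.

Definition delta (x : X) : ell2 := Ell2 (delta_subproof x).

Fact precomp_subproof (s : X -> X) (sI : injective s) (f : ell2) :
  (f : X -> R[i]^o) \o s \in sqsummable.
Proof. exact: sqsum_inj (ell2P f). Qed.

Definition precomp (s : X -> X) (sI : injective s) (f : ell2) : ell2 :=
  Ell2 (precomp_subproof sI f).

End Ell2.

Definition directed (I : Type) (le : I -> I -> Prop) : Prop :=
  [/\ inhabited I, (forall i, le i i),
      (forall i j k, le i j -> le j k -> le i k) &
      (forall i j, exists k, le i k /\ le j k)].

(* [f @ tails le --> l] is convergence of the net [f] to [l] *)
Definition tails (I : Type) (le : I -> I -> Prop) : set_system I :=
  filter_from [set: I] (fun i => [set j | le i j]).

(* Every Hilbert space is isomorphic to some l^2(X), so there is no loss of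
   generality in only considering operator algebras on l^2(X). *)

Section VonNeumann.
Variables (R : realType) (X : choiceType).
Local Notation op := (ell2 R X -> ell2 R X).
Implicit Types (S A B M N : set op) (T x y u : op) (tau : op -> R[i]).

Definition bounded_op : set op := [set T | linear T /\ continuous T].

Definition is_adjoint T T' : Prop :=
  forall f g, inner (T f) g = inner f (T' g).

(* only meaningful when [T] is bounded, in which case [T'] exists uniquely *)
Definition adj T : op :=
  xget (fun=> 0) [set T' | bounded_op T' /\ is_adjoint T T'].

Definition positive_op T : Prop := forall f, 0 <= inner (T f) f.

Definition commutant S : set op :=
  [set T | bounded_op T /\ forall s, S s -> T \o s = s \o T].

(* A commutant is always a unital algebra, so these are the unital
   *-subalgebras of the bounded operators which equal their bicommutant. *)
Definition von_neumann_algebra A : Prop :=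
  [/\ A `<=` bounded_op, (forall T, A T -> A (adj T)) &
      commutant (commutant A) = A].

Definition vn_generated S : set op :=
  [set T | forall A, von_neumann_algebra A -> S `<=` A -> A T].

(* The [tau]-preserving conditional expectations from [M] onto [N];
   [E x] is left unconstrained for [x] outside of [M] *)
Definition is_condexp tau M N (E : op -> op) : Prop :=
  [/\ (forall x, M x -> N (E x)),
      (forall (a : R[i]) x y, M x -> M y -> E (a *: x + y) = a *: E x + E y),
      (forall x, N x -> E x = x),
      (forall a b x, N a -> N b -> M x -> E (a \o x \o b) = a \o E x \o b) &
      (forall x, M x -> positive_op x -> positive_op (E x)) /\
      (forall x, M x -> tau (E x) = tau x)].

(* the default [fun x => x] is irrelevant when a conditional expectation exists,
   which is the case when [tau] is a faithful normal trace on [M] *)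
Definition condexp tau M N : op -> op := xget (fun x : op => x) (is_condexp tau M N).

Definition ominus tau M N : set op := [set x | M x /\ condexp tau M N x = 0].

(* [tau (x^* x)] is a nonnegative real number when [tau] is positive *)
Definition norm2 tau x : R := Num.sqrt (complex.Re (tau (adj x \o x))).

Definition unitaries B : set op :=
  [set u | [/\ B u, adj u \o u = id & u \o adj u = id]].

Definition relative_wahp tau B N M : Prop :=
  exists (I : Type) (le : I -> I -> Prop) (u : I -> op),
    [/\ directed le, (forall i, unitaries B (u i)) &
        forall x y, ominus tau M N x -> ominus tau M N y ->
          (fun i => norm2 tau (condexp tau M B (x \o u i \o y))) @ tails le
            --> (0 : R)].

End VonNeumann.

Section GroupAlgebra.
Variables (R : realType) (G : groupType).
Implicit Types (g : G) (S : set G).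

Definition lambda_op g : ell2 R G -> ell2 R G := precomp (@mulgI G g^-1%g).

Definition group_vna S : set (ell2 R G -> ell2 R G) :=
  vn_generated [set lambda_op s | s in S].

Definition canonical_trace (x : ell2 R G -> ell2 R G) : R[i] :=
  inner (x (delta R 1%g)) (delta R 1%g).

End GroupAlgebra.
Arguments lambda_op R {G} g.
Arguments group_vna R {G} S.
Arguments canonical_trace R G x : clear implicits.

Section Cosets.
Variable G : groupType.
Implicit Types (g : G) (A C F H K : set G).

Definition prodset A C : set G := [set (a * c)%g | a in A & c in C].

Definition quasi_normalizer1 H : set G :=
  [set g | exists F, finite_set F /\ prodset H [set g] `<=` prodset F H].

Definition left_coset H g : set G := [set (g * h)%g | h in H].

Definition left_cosets H : set (set G) := [set left_coset H g | g in [set: G]].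

Fact coset_translate_subproof H g (A : left_cosets H) :
  [set (g * a)%g | a in val A] \in left_cosets H.
Proof.
case: A => A /= /set_mem[k _ <-]; apply/mem_set; exists (g * k)%g => //.
rewrite /left_coset image_comp; apply/seteqP.
by split=> _ [h Hh <-]; exists h => //=; rewrite mulgA.
Qed.

Definition coset_translate H g (A : left_cosets H) : left_cosets H :=
  exist _ [set (g * a)%g | a in val A] (coset_translate_subproof g A).

Fact coset_translate_inj H g : injective (@coset_translate H g).
Proof.
have mulgS (A B : set G) :
    [set (g * a)%g | a in A] `<=` [set (g * b)%g | b in B] -> A `<=` B.
  by move=> AB a Aa; have /= [|b Bb /mulgI <-//] := AB (g * a)%g; exists a.
move=> A B /(congr1 val)/= AB; apply/val_inj/seteqP.
by split; apply: mulgS; rewrite AB.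
Qed.

Variable R : realType.

Definition quasi_regular H g : ell2 R (left_cosets H) -> ell2 R (left_cosets H) :=
  precomp (@coset_translate_inj H g^-1%g).

Definition compact_vectors H : set (ell2 R (left_cosets H)) :=
  [set xi | compact (closure [set quasi_regular h xi | h in H])].

Definition invariant_vectors H : set (ell2 R (left_cosets H)) :=
  [set xi | forall h, H h -> quasi_regular h xi = xi].

(* l^2(K/H) inside l^2(G/H) *)
Definition supported_in H K : set (ell2 R (left_cosets H)) :=
  [set xi | forall A : left_cosets H,
     ~ (exists2 k, K k & val A = left_coset H k) -> xi A = 0].

End Cosets.
Arguments compact_vectors {G} R H.
Arguments invariant_vectors {G} R H.
Arguments supported_in {G} R H K.

(* Main.v *)
(* (1) => (2) is immediate. The conditional expectation of L(G) onto L(K) is the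
   pinching x |-> \sum_C P_C x P_C over the right cosets C = K g, P_C being the
   restriction to C, so that (E x) delta_e is the restriction of x delta_e to K.

   (2) => (3): if H g is contained in F H with g outside K, then F can be taken
   disjoint from K, and for every unitary u of L(H) the restrictions to H of
   lambda_f^* u lambda_g delta_e, f in F, carry together at least the mass
   ||u delta_e||^2 = 1. So they cannot all be small.

   (3) => (4): by total boundedness of its orbit, an H-compact vector which does
   not vanish at g H is uniformly large at h g H, h in H, for one of finitely many
   vectors; so the H-orbit of g H is finite.

   (4) => (5): the orbit of an invariant vector is a singleton.

   (5) => (6): by (5) the points of G/H outside K/H have infinite H-orbits, as the
   indicator function of a finite orbit is invariant. P. M. Neumann's separation
   lemma then gives h in H moving the cosets f H, f in F, off the cosets f^-1 H.

   (6) => (1): the net is indexed by the finite subsets J of G, with h_J given by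
   (6) for J \ K; approximate x delta_e and y delta_e by finitely supported
   vectors. *)

Require Import Defs.
From HB Require Import structures.
From mathcomp Require Import all_boot all_order all_algebra finmap.
From mathcomp Require Import complex.
From mathcomp Require Import all_classical all_reals all_analysis.
From mathcomp Require Import summability.
From mathcomp Require Import ring lra.

Set Implicit Arguments.
Unset Strict Implicit.
Unset Printing Implicit Defensive.

Import Order.TTheory GRing.Theory Num.Theory.
Import numFieldNormedType.Exports.

Local Open Scope classical_set_scope.
Local Open Scope ring_scope.

#[local] Existing Instance totally_filter.

(** * The inner product of l^2(X) *)

Section Inner.
Variables (R : realType) (X : choiceType).
Local Notation C := R[i].
Implicit Types (f g h : ell2 R X) (a : C) (x y : X) (S : set X).

Lemma normr_complexE a : `|a| = (Normc.normc a)%:C%C.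
Proof. by case: a. Qed.

Lemma ge0_complexP a : 0 <= a -> exists2 e : R, 0 <= e & a = e%:C%C.
Proof. by case: a => u v; rewrite lecE /= => /andP[/eqP -> u0]; exists u. Qed.

Lemma gt0_complexP a : 0 < a -> exists2 e : R, 0 < e & a = e%:C%C.
Proof. by case: a => u v; rewrite ltcE /= => /andP[/eqP -> u0]; exists u. Qed.

Lemma ell2_normE f : `|f| = (ell2_norm f)%:C%C.
Proof. by []. Qed.

Lemma sum_le_sqsum f (J : {fset X}) :
  (\sum_(x <- J) (Normc.normc (f x) ^+ 2)%:E <= sqsum f)%E.
Proof.
apply: esum_ge; exists [set` J] => //.
by rewrite fsbig_finite//= set_fsetK.
Qed.

(** [sqsum] is a supremum over finite sets, whereas [inner] is a limit along the filter of finite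
    sets. As the terms are nonnegative, once a finite set comes within e of the supremum, so does
    every larger one. *)
Lemma sqsum_cvg f :
  partial_sum (fun x => `|f x : C| ^+ 2 : C^o) @ totally --> (`|f| ^+ 2 : C^o).
Proof.
apply/cvgrPdist_le => _ /gt0_complexP[e e0 ->].
have foo := ell2P f.
have [_ [F [finF _]] <- lF] : exists2 z,
    [set (\sum_(x \in A) (Normc.normc (f x) ^+ 2)%:E)%E | A in fsets [set: X]] z
    & (sqsum f - e%:E < z)%E.
  apply: ub_ereal_sup_adherent => //.
  by rewrite -/(sqsum f) ge0_fin_numE ?sqsum_ge0.
exists (fset_set F) => // J /= FJ.
have -> : partial_sum (fun x => `|f x : C| ^+ 2 : C^o) J =
    (\sum_(x <- J) Normc.normc (f x) ^+ 2)%:C%C.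
  rewrite /partial_sum -(big_seq_fsetE _ _ xpredT (fun x => `|f x : C| ^+ 2 : C^o)) /=.
  rewrite rmorph_sum; apply: eq_bigr => x _ /=.
  by rewrite normr_complexE rmorphXn.
have leJ := sum_le_sqsum f J.
have leF : (\sum_(x \in F) (Normc.normc (f x) ^+ 2)%:E <=
    \sum_(x <- J) (Normc.normc (f x) ^+ 2)%:E)%E.
  have -> : (\sum_(x <- J) (Normc.normc (f x) ^+ 2)%:E =
      \sum_(x \in [set` J]) (Normc.normc (f x) ^+ 2)%:E)%E.
    by rewrite fsbig_finite//= set_fsetK.
  apply: lee_fsum_nneg_subset => //.
  - move=> x; rewrite inE => Fx.
    by rewrite inE/=; apply: (fsubsetP FJ); rewrite in_fset_set// inE.
  - by move=> x _; rewrite lee_fin sqr_ge0.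
move: lF leJ => /lt_le_trans/(_ leF).
rewrite ell2_normE -rmorphXn -rmorphB normr_complexE /= lecR expr0n addr0 sqrtr_sqr.
rewrite -sqr_ell2_norm sumEFin -EFinB lte_fin lee_fin => lJ leJ.
by rewrite ger0_norm ?subr_ge0// lerBlDl -lerBlDr ltW.
Qed.

(* Polarization reduces the convergence of the sums defining [inner] to that of
   sums of squares, so that completeness of [C] is not needed. *)
Lemma polarization (z w : C) : z * w^* = 4^-1 * (`|z + w| ^+ 2 - `|z - w| ^+ 2
  + 'i * (`|z + 'i * w| ^+ 2 - `|z - 'i * w| ^+ 2)).
Proof.
rewrite !normCK !rmorphD !rmorphN !rmorphM /= conjCi.
have ii : 'i * 'i = -1 :> C by rewrite -expr2 sqrCi.
transitivity (4^-1 * (2 * (z * w^* + w * z^*)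
  + 'i * 'i * (2 * (w * z^* - z * w^*)))); last by ring.
by rewrite ii; field.
Qed.

Lemma inner_polar f g : partial_sum (fun x => f x * (g x : C)^* : C^o) @ totally -->
  (4^-1 * (`|f + g| ^+ 2 - `|f - g| ^+ 2
    + 'i * (`|f + 'i *: g| ^+ 2 - `|f - 'i *: g| ^+ 2)) : C^o).
Proof.
have -> : partial_sum (fun x => f x * (g x : C)^* : C^o) = fun J =>
    4^-1 * (partial_sum (fun x => `|(f + g) x : C| ^+ 2 : C^o) J -
            partial_sum (fun x => `|(f - g) x : C| ^+ 2 : C^o) J +
     'i * (partial_sum (fun x => `|(f + 'i *: g) x : C| ^+ 2 : C^o) J -
           partial_sum (fun x => `|(f - 'i *: g) x : C| ^+ 2 : C^o) J)) : C^o.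
  apply/funext => J; rewrite /partial_sum -!sumrB mulr_sumr -big_split mulr_sumr.
  by apply: eq_bigr => x _; exact: polarization.
apply: cvgMr; apply: cvgD; first by apply: cvgB; exact: sqsum_cvg.
by apply: cvgMr; apply: cvgB; exact: sqsum_cvg.
Qed.

Lemma inner_cvg f g :
  partial_sum (fun x => f x * (g x : C)^* : C^o) @ totally --> (inner f g : C^o).
Proof. have /cvgP := @inner_polar f g; exact. Qed.

Lemma innerE f g (l : C) :
  partial_sum (fun x => f x * (g x : C)^* : C^o) @ totally --> (l : C^o) ->
  inner f g = l.
Proof.
move=> fl; rewrite /inner /summability.sum.
by apply: (@cvg_lim C^o) => //; exact: norm_hausdorff.
Qed.

Lemma innerff f : inner f f = `|f| ^+ 2.
Proof.
apply: innerE; have := @sqsum_cvg f.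
by under eq_fun do rewrite normCK.
Qed.

(** Read off the polarized value: [g + 'i *: f] is 'i times [f - 'i *: g], so exchanging f and g
    exchanges the two norms in the imaginary part. *)
Lemma inner_conj f g : inner g f = (inner f g)^*.
Proof.
rewrite (innerE (@inner_polar f g)) (innerE (@inner_polar g f)).
have conjn h : ((`|h| ^+ 2) ^* : C) = `|h| ^+ 2.
  by apply/conj_Creal/ger0_real; rewrite exprn_ge0.
rewrite rmorphM rmorphD !rmorphB [in RHS]rmorphM rmorphB /= conjCi !conjn.
rewrite fmorphV rmorph_nat.
have ni : `|'i : C| = 1 by rewrite normCi.
have -> : `|g + 'i *: f| = `|f - 'i *: g|.
  have -> : g + 'i *: f = 'i *: (f - 'i *: g); last by rewrite normrZ ni mul1r.
  by rewrite scalerBr scalerA -expr2 sqrCi scaleN1r opprK addrC.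
have -> : `|g - 'i *: f| = `|f + 'i *: g|.
  have -> : g - 'i *: f = - 'i *: (f + 'i *: g).
    by rewrite scalerDr scalerA mulNr -expr2 sqrCi opprK scale1r scaleNr addrC.
  by rewrite normrZ normrN ni mul1r.
by rewrite (addrC g) (distrC g); ring.
Qed.

Lemma innerDZl a f g h : inner (a *: f + g) h = a * inner f h + inner g h.
Proof.
apply: innerE.
have -> : partial_sum (fun x => (a *: f + g) x * (h x : C)^* : C^o) = fun J =>
    a * partial_sum (fun x => f x * (h x : C)^* : C^o) J +
    partial_sum (fun x => g x * (h x : C)^* : C^o) J : C^o.
  apply/funext => J; rewrite /partial_sum mulr_sumr -big_split.
  by apply: eq_bigr => x _; rewrite [in RHS]mulrA; exact: mulrDl.
by apply: cvgD; [apply: cvgMr|]; exact: inner_cvg.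
Qed.

Lemma inner0l h : inner 0 h = 0.
Proof. by have := innerDZl (-1) 0 0 h; rewrite scaler0 add0r mulN1r addNr. Qed.

Lemma innerDl f g h : inner (f + g) h = inner f h + inner g h.
Proof. by rewrite -{1}[f]scale1r innerDZl mul1r. Qed.

Lemma innerZl a f h : inner (a *: f) h = a * inner f h.
Proof. by rewrite -[a *: f]addr0 innerDZl inner0l addr0. Qed.

Lemma innerNl f h : inner (- f) h = - inner f h.
Proof. by rewrite -scaleN1r innerZl mulN1r. Qed.

Lemma innerBl f g h : inner (f - g) h = inner f h - inner g h.
Proof. by rewrite innerDl innerNl. Qed.

Lemma innerZr a f h : inner h (a *: f) = a^* * inner h f.
Proof. by rewrite inner_conj innerZl rmorphM /= -inner_conj. Qed.

Lemma inner0r h : inner h 0 = 0.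
Proof. by rewrite inner_conj inner0l rmorph0. Qed.

Lemma innerBr f g h : inner h (f - g) = inner h f - inner h g.
Proof. by rewrite inner_conj innerBl rmorphB /= -!inner_conj. Qed.

Lemma cauchy_schwarz f g : `|inner f g| <= `|f| * `|g|.
Proof.
have [->|g0] := eqVneq g 0; first by rewrite inner0r !normr0 mulr0.
have gg0 : 0 < `|g| ^+ 2 by rewrite exprn_gt0// normr_gt0.
rewrite -(@ler_pXn2r _ 2) ?nnegrE ?mulr_ge0// exprMn -ler_pdivrMr//.
rewrite -subr_ge0; set t := inner f g.
(* The vector subtracted from f is its orthogonal projection onto the line of g. *)
have : 0 <= `|f - (t / `|g| ^+ 2) *: g| ^+ 2 by rewrite exprn_ge0.
rewrite -innerff innerBl !innerBr innerZl !innerZr innerZl (inner_conj f g) -/t.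
rewrite !innerff rmorphM fmorphV /= (@conj_Creal _ (`|g| ^+ 2)); last first.
  by rewrite ger0_real// ltW.
rewrite normCK => le0; congr (is_true (0 <= _)): le0.
have := gt_eqF gg0; move: (`|g| ^+ 2) => n n0.
by field; rewrite n0.
Qed.

Lemma inner_finite f g (J : {fset X}) :
  (forall x, x \notin J -> f x * (g x : C)^* = 0) ->
  inner f g = \sum_(x <- J) f x * (g x : C)^*.
Proof.
move=> J0; apply: innerE; apply: cvg_near_cst.
exists J => // B /= JB.
rewrite /partial_sum -(big_seq_fsetE _ _ xpredT (fun x => f x * (g x : C)^*)) /=.
by apply/esym/big_fset_incl => // x _; exact: J0.
Qed.

Lemma innerDelta f x : inner f (delta R x) = f x.
Proof.
rewrite (@inner_finite _ _ [fset x]%fset) ?big_seq_fset1 /= ?eqxx ?conjC1 ?mulr1//.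
by move=> y; rewrite inE => /negbTE ->; rewrite conjC0 mulr0.
Qed.

Lemma innerDeltal f x : inner (delta R x) f = (f x : C)^*.
Proof. by rewrite inner_conj innerDelta. Qed.

Lemma norm_delta x : `|delta R x| = 1 :> C.
Proof.
apply/eqP; rewrite -(@eqrXn2 _ 2)// expr1n -innerff innerDelta /=.
by rewrite eqxx.
Qed.

Lemma ell2_ext f g : (forall x, f x = g x) -> f = g.
Proof. by move=> fg; apply/val_inj/funext. Qed.

Lemma inner_ext f g : (forall h, inner f h = inner g h) -> f = g.
Proof. by move=> fg; apply: ell2_ext => x; rewrite -!innerDelta. Qed.

(** The sum is unordered, and a bijection of the index set preserves the filter of finite subsets.
    Only the products of coordinates are compared, so that f and g may be exchanged for vectors
    which are not their translates. *)
Lemma inner_bij f g f' g' (s : X -> X) : bijective s ->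
  (forall x, f x * (g x : C)^* = f' (s x) * (g' (s x) : C)^*) ->
  inner f g = inner f' g'.
Proof.
move=> [t st ts] fg; apply/esym/innerE.
have fs J : partial_sum (fun x => f' x * (g' x : C)^* : C^o) J =
    partial_sum (fun x => f x * (g x : C)^* : C^o) (t @` J)%fset.
  rewrite /partial_sum -(big_seq_fsetE _ _ xpredT (fun x => f x * (g x : C)^*)) /=.
  rewrite -(big_seq_fsetE _ _ xpredT (fun x => f' x * (g' x : C)^*)) /=.
  rewrite big_imfset /=; last by move=> x y _ _; exact: (can_inj ts).
  by apply: eq_bigr => x _; rewrite fg ts.
rewrite (funext fs).
apply: (@cvg_comp _ _ _ (fun J : {fset X} => (t @` J)%fset) _ totally totally);
  last exact: inner_cvg.
move=> A [J _ JA]; exists (s @` J)%fset => // B /= sJB.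
apply: JA => /=; apply/fsubsetP => x xJ.
apply/imfsetP; exists (s x) => //=.
by apply: (fsubsetP sJB); apply/imfsetP; exists x.
Qed.

End Inner.

(** * Restrictions, density of the finitely supported vectors, Riesz's theorem *)

Section Operators.
Variables (R : realType) (X : choiceType).
Local Notation C := R[i].
Implicit Types (f g h : ell2 R X) (a k : C) (x y : X) (S : set X).

Lemma ell2DE f g x : (f + g) x = (f x : C) + g x. Proof. by []. Qed.

Lemma ell2ZE a f x : (a *: f) x = a * (f x : C). Proof. by []. Qed.

Lemma ell2BE f g x : (f - g) x = (f x : C) - g x. Proof. by []. Qed.

Fact restr_subproof S f :
  (fun x => if x \in S then f x else 0 : C^o) \in @sqsummable R X.
Proof.
apply: le_lt_trans (ell2P f); apply: le_esum => x _.
by case: ifP => // _; rewrite lee_fin Normc.normc0 expr0n sqr_ge0.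
Qed.

Definition restr S f : ell2 R X := Ell2 (restr_subproof S f).

Lemma restrE S f x : restr S f x = if x \in S then f x else 0.
Proof. by []. Qed.

Lemma restr_linear S : linear (restr S).
Proof.
move=> a f g; apply: ell2_ext => x; rewrite restrE !ell2DE !ell2ZE !restrE.
by case: ifP => // _; rewrite mulr0 addr0.
Qed.

Lemma inner_restr S f g : inner (restr S f) g = inner f (restr S g).
Proof.
apply: (@inner_bij _ _ _ _ _ _ id) => [|x]; first by exists id.
by rewrite !restrE; case: ifP => _; rewrite ?mul0r ?conjC0 ?mulr0.
Qed.

Lemma restr_id S f : restr S (restr S f) = restr S f.
Proof. by apply: ell2_ext => x; rewrite !restrE; case: (x \in S). Qed.

Lemma restr_delta S x : x \in S -> restr S (delta R x) = delta R x.
Proof.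
move=> xS; apply: ell2_ext => y; rewrite restrE /=.
by case: eqVneq => [->|_]; rewrite ?xS ?if_same.
Qed.

Lemma pythagoras S f : `|f| ^+ 2 = `|restr S f| ^+ 2 + `|f - restr S f| ^+ 2.
Proof.
rewrite -!innerff innerBl !innerBr !inner_restr restr_id.
by rewrite -(inner_restr S f f) inner_restr; ring.
Qed.

Lemma ler_restr S f : `|restr S f| <= `|f|.
Proof.
rewrite -(@ler_pXn2r _ 2) ?nnegrE// (pythagoras S f).
by rewrite lerDl exprn_ge0.
Qed.

Lemma norm_restr_fset (J : {fset X}) f :
  `|restr [set` J] f| ^+ 2 = \sum_(x <- J) `|f x : C| ^+ 2.
Proof.
rewrite -innerff (@inner_finite _ _ _ _ J) => [|x /negbTE xJ]; last first.
  by rewrite restrE mem_setE xJ mul0r.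
rewrite !big_seq; apply: eq_bigr => x xJ.
by rewrite restrE mem_setE xJ -normCK.
Qed.

Lemma sum_deltaE (u : X -> C) (J : {fset X}) y :
  (\sum_(x <- J) u x *: delta R x) y = if y \in J then u y else 0.
Proof.
rewrite -innerDelta.
rewrite (big_morph (fun w => inner w _) (fun w w' => innerDl w w' _) (inner0l _)).
case: ifP => yJ.
  rewrite (big_fsetD1 y)//= innerZl innerDelta /= eqxx mulr1 big_seq big1 ?addr0//.
  move=> x; rewrite !inE => /andP[/negbTE xy _].
  by rewrite innerZl innerDelta /= eq_sym xy mulr0.
rewrite big_seq big1// => x xJ; rewrite innerZl innerDelta /=.
by case: eqVneq xJ => [<-|]; rewrite ?yJ// mulr0.
Qed.

Lemma restr_fset (J : {fset X}) f :
  restr [set` J] f = \sum_(x <- J) (f x : C) *: delta R x.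
Proof. by apply: ell2_ext => y; rewrite sum_deltaE restrE mem_setE. Qed.

(** By [pythagoras], the squared norm of the tail is the squared norm of f minus a partial sum. *)
Lemma finite_approx f (e : C) : 0 < e ->
  exists J : {fset X}, `|f - restr [set` J] f| < e.
Proof.
move=> e0; have e20 : 0 < e ^+ 2 by rewrite exprn_gt0.
have /cvgrPdist_lt h := @sqsum_cvg _ _ f.
have [J _ lJ'] := h _ e20; exists J.
move: (lJ' J (fsubset_refl _)) => /= lJ.
rewrite -(@ltr_pXn2r _ 2) ?nnegrE ?(ltW e0)//.
move: lJ; rewrite /partial_sum.
rewrite -(big_seq_fsetE _ _ xpredT (fun x => `|f x : C| ^+ 2)) /=.
by rewrite -norm_restr_fset (pythagoras [set` J] f) addrAC subrr add0r ger0_norm //.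
Qed.

Lemma scalar_sum (phi : ell2 R X -> C) (r : seq X) (u : X -> C)
    (F : X -> ell2 R X) : scalar phi ->
  phi (\sum_(x <- r) u x *: F x) = \sum_(x <- r) u x * phi (F x).
Proof.
move=> lphi; elim/big_rec2: _ => [|x a f _ <-]; last exact: lphi.
by have := lphi (-1) 0 0; rewrite scaler0 addr0 /= mulN1r addNr.
Qed.

(** By linearity phi vanishes on finitely supported vectors, which are dense. Dividing by k + 1
    rather than k covers the case k = 0. *)
Lemma functional_eq0 (phi : ell2 R X -> C) k : 0 <= k ->
  scalar phi -> (forall f, `|phi f| <= k * `|f|) ->
  (forall x, phi (delta R x) = 0) -> forall f, phi f = 0.
Proof.
move=> k0 lphi bphi phi0 f.
apply/eqP; rewrite -normr_le0; apply/ler_addgt0Pl => e e0; rewrite addr0.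
have k1 : 0 < k + 1 by rewrite ltr_wpDl.
have [J lJ] : exists J : {fset X}, `|f - restr [set` J] f| < e / (k + 1).
  by apply: finite_approx; rewrite divr_gt0.
have -> : phi f = phi (f - restr [set` J] f).
  have phir : phi (restr [set` J] f) = 0.
    by rewrite restr_fset scalar_sum// big1// => x _; rewrite phi0 mulr0.
  rewrite -[RHS]addr0 -phir -[phi (f - _)]mul1r.
  by rewrite -lphi scale1r subrK.
apply: le_trans (bphi _) _.
apply: (@le_trans _ _ ((k + 1) * (e / (k + 1)))).
  by apply: ler_pM => //; rewrite ?ltW// ltrDl.
by rewrite mulrC divfK// gt_eqF.
Qed.

(** The coordinates u of the representing vector are forced. Evaluating phi at a finite truncation v
    of u gives |v|^2 <= k |v|, which bounds the partial sums and makes u square summable; then phi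
    and the inner product with u agree on the basis, hence everywhere. *)
Lemma riesz (phi : ell2 R X -> C) k : 0 <= k ->
  scalar phi -> (forall f, `|phi f| <= k * `|f|) ->
  exists h, forall f, phi f = inner f h.
Proof.
move=> k0 lphi bphi.
pose u x : C^o := (phi (delta R x))^*.
have uJ (J : {fset X}) : \sum_(x <- J) `|u x : C| ^+ 2 <= k ^+ 2.
  pose v := \sum_(x <- J) (u x : C) *: delta R x.
  have vE y : v y = if y \in J then u y else 0 by exact: sum_deltaE.
  have vv : `|v| ^+ 2 = \sum_(x <- J) `|u x : C| ^+ 2.
    rewrite -innerff (@inner_finite _ _ _ _ J) => [|x /negbTE xJ]; last first.
      by rewrite vE xJ mul0r.
    by rewrite !big_seq; apply: eq_bigr => x xJ; rewrite vE xJ -normCK.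
  have phiv : phi v = `|v| ^+ 2.
    rewrite vv /v scalar_sum//; apply: eq_bigr => x _.
    by rewrite normCK /u conjCK.
  have := bphi v; rewrite phiv ger0_norm ?exprn_ge0//.
  have [v0 _|v0] := eqVneq v 0; first by rewrite -vv v0 normr0 expr0n exprn_ge0.
  rewrite expr2 ler_pM2r ?normr_gt0// => vk.
  by rewrite -vv ler_pXn2r ?nnegrE.
have uoo : u \in @sqsummable R X.
  have [K K0 kK] := ge0_complexP (exprn_ge0 2 k0).
  apply: (@le_lt_trans _ _ K%:E); last exact: ltry.
  apply: ge_ereal_sup => _ [A [finA _] <-].
  rewrite fsbig_finite//= sumEFin lee_fin -lecR -kK rmorph_sum.
  rewrite (eq_bigr (fun x => `|u x : C| ^+ 2)) ?uJ// => x _.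
  by rewrite normr_complexE rmorphXn.
exists (Ell2 uoo) => f; apply/eqP; rewrite -subr_eq0; apply/eqP; move: f.
apply: (@functional_eq0 _ (k + `|Ell2 uoo|)) => [|a f g|f|x].
- by rewrite addr_ge0.
- by rewrite lphi innerDZl /=; ring.
- by rewrite mulrDl (le_trans (ler_normB _ _))// lerD// mulrC cauchy_schwarz.
- by rewrite innerDeltal /= /u conjCK subrr.
Qed.

End Operators.

(** * Adjoints and bicommutants *)

Section Adjoint.
Variables (R : realType) (X : choiceType).
Local Notation C := R[i].
Implicit Types (f g h : ell2 R X) (a k : C) (x y : X).
Implicit Types (T : ell2 R X -> ell2 R X) (A S : set (ell2 R X -> ell2 R X)).

Lemma bounded_opP T :
  bounded_op T <-> linear T /\ exists2 k : C, 0 <= k & forall f, `|T f| <= k * `|f|.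
Proof.
split=> -[lT]; pose TL : {linear ell2 R X -> ell2 R X} :=
    HB.pack T (GRing.isLinear.Build _ _ _ _ T lT).
  move=> cT; split=> //; have : continuous TL := cT.
  move=> /linear_bounded_continuous/linear_boundedP/pinfty_ex_gt0[k k0 Tk].
  by exists k => //; exact: ltW.
move=> [k k0 Tk]; split=> //.
suff : continuous TL by [].
apply/linear_bounded_continuous/linear_boundedP.
exists k; split; first exact: ger0_real.
move=> r kr f; apply: le_trans (Tk f) _.
by rewrite ler_wpM2r// ltW.
Qed.

Section Linear.
Variables (T : ell2 R X -> ell2 R X) (bT : bounded_op T).

Lemma bopDZ a f g : T (a *: f + g) = a *: T f + T g.
Proof. by case: bT => lT _; rewrite lT. Qed.

Lemma bopD f g : T (f + g) = T f + T g.
Proof. by rewrite -[f]scale1r bopDZ !scale1r. Qed.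

Lemma bop0 : T 0 = 0.
Proof. by apply: (addrI (T 0)); rewrite -bopD !addr0. Qed.

Lemma bopZ a f : T (a *: f) = a *: T f.
Proof. by rewrite -[a *: f]addr0 bopDZ bop0 addr0. Qed.

Lemma bopB f g : T (f - g) = T f - T g.
Proof. by rewrite bopD -scaleN1r bopZ scaleN1r. Qed.

Lemma bop_sum (I : Type) (r : seq I) (F : I -> ell2 R X) :
  T (\sum_(i <- r) F i) = \sum_(i <- r) T (F i).
Proof. exact: (big_morph T bopD bop0). Qed.

End Linear.

Lemma bounded_comp T T' : bounded_op T -> bounded_op T' -> bounded_op (T \o T').
Proof.
move=> bT bT'; apply/bounded_opP; split.
  by move=> a f g /=; rewrite !bopDZ.
case/bounded_opP: bT => _ [k k0 Tk]; case/bounded_opP: bT' => _ [k' k'0 Tk'].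
exists (k * k'); rewrite ?mulr_ge0// => f /=.
by rewrite (le_trans (Tk _))// -mulrA ler_wpM2l.
Qed.

Lemma is_adjoint_sym T T' : is_adjoint T T' -> is_adjoint T' T.
Proof. by move=> TT' f g; rewrite inner_conj -TT' -inner_conj. Qed.

(** Riesz's theorem provides T' pointwise. Its bound comes from |T' f|^2 = (T T' f, f) <= k |T' f|
    |f|. *)
Lemma adjoint_exists T : bounded_op T -> exists T', bounded_op T' /\ is_adjoint T T'.
Proof.
move=> bT; have [lT [k k0 Tk]] := (bounded_opP T).1 bT.
have ex g : exists h, forall f, inner (T f) g = inner f h.
  apply: (@riesz _ _ _ (k * `|g|)); first by rewrite mulr_ge0.
    by move=> a u v /=; rewrite lT innerDZl.
  by move=> f; rewrite (le_trans (cauchy_schwarz _ _))// mulrAC ler_wpM2r.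
pose T' g := projT1 (cid (ex g)).
have T'P f g : inner (T f) g = inner f (T' g) by rewrite /T'; case: cid.
have T'P' : is_adjoint T' T by apply: is_adjoint_sym.
exists T'; split=> //; apply/bounded_opP; split.
  by move=> a f g; apply: inner_ext => h; rewrite innerDZl !T'P' innerDZl.
exists k => // f; have [->|Tf0] := eqVneq (T' f) 0.
  by rewrite normr0 mulr_ge0.
have : `|T' f| ^+ 2 <= k * `|T' f| * `|f|.
  rewrite -innerff -T'P -[inner _ _]ger0_norm; last first.
    by rewrite T'P innerff exprn_ge0.
  by rewrite (le_trans (cauchy_schwarz _ _))// ler_wpM2r.
by rewrite mulrAC expr2 ler_pM2r ?normr_gt0.
Qed.

Lemma is_adjoint_uniq T T1 T2 : is_adjoint T T1 -> is_adjoint T T2 -> T1 = T2.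
Proof.
move=> TT1 TT2; apply/funext => f; apply: inner_ext => h.
by rewrite (is_adjoint_sym TT1) (is_adjoint_sym TT2).
Qed.

Lemma adjP T : bounded_op T -> bounded_op (adj T) /\ is_adjoint T (adj T).
Proof. by move=> /adjoint_exists[T' TT']; exact: (@xgetPex _ _
  [set S | bounded_op S /\ is_adjoint T S] (ex_intro _ T' TT')). Qed.

Lemma adj_bounded T : bounded_op T -> bounded_op (adj T).
Proof. by case/adjP. Qed.

Lemma adjE T f g : bounded_op T -> inner (T f) g = inner f (adj T g).
Proof. by case/adjP. Qed.

Lemma adjEl T f g : bounded_op T -> inner (adj T f) g = inner f (T g).
Proof. by case/adjP => _ /is_adjoint_sym. Qed.

Lemma eq_adj T T' : bounded_op T -> is_adjoint T T' -> adj T = T'.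
Proof. by case/adjP => _; exact: is_adjoint_uniq. Qed.

(** The matrix entries are, up to conjugation, the coordinates of the adjoint at basis vectors, and
    these determine every coordinate of T f. *)
Lemma eq_bounded_op T T' : bounded_op T -> bounded_op T' ->
  (forall x y, T (delta R x) y = T' (delta R x) y) -> T = T'.
Proof.
move=> bT bT' TT'; apply/funext => f; apply: ell2_ext => y.
rewrite -!innerDelta !adjE//; congr inner; apply: ell2_ext => x.
by rewrite -!innerDelta !adjEl// !innerDeltal TT'.
Qed.

Lemma commutantS A S : A `<=` S -> commutant S `<=` commutant A.
Proof. by move=> AS T [bT cT]; split=> // s /AS; exact: cT. Qed.

Lemma sub_bicommutant A : A `<=` @bounded_op R X -> A `<=` commutant (commutant A).
Proof. by move=> bA T AT; split=> [|s [_ cs]]; [exact: bA|rewrite cs]. Qed.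

Lemma commutant_adj A : A `<=` @bounded_op R X -> (forall T, A T -> A (adj T)) ->
  forall T, commutant A T -> commutant A (adj T).
Proof.
move=> bA aA T [bT cT]; split=> [|s As]; first exact: adj_bounded.
apply/funext => f; apply: inner_ext => h /=.
have bs := bA _ As.
rewrite adjEl// !(adjE _ _ bs) adjEl//.
by have /(congr1 (fun u => u h))/= -> := cT _ (aA _ As).
Qed.

Lemma vn_bicommutant A : A `<=` @bounded_op R X -> (forall T, A T -> A (adj T)) ->
  von_neumann_algebra (commutant (commutant A)).
Proof.
move=> bA aA; split.
- by move=> T [].
- apply: commutant_adj; first by move=> T [].
  exact: commutant_adj.
- apply/seteqP; split.
    apply: commutantS; apply: sub_bicommutant.
    by move=> T [].
  by apply: sub_bicommutant => T [].
Qed.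

(** For a self-adjoint A the bicommutant is itself a von Neumann algebra, and any von Neumann
    algebra containing A contains it because taking bicommutants is monotone. *)
Lemma vn_generatedE A : A `<=` @bounded_op R X -> (forall T, A T -> A (adj T)) ->
  vn_generated A = commutant (commutant A).
Proof.
move=> bA aA; apply/seteqP; split => T.
  by apply; [exact: vn_bicommutant|exact: sub_bicommutant].
move=> AT B [bB aB cB] AB; rewrite -cB.
by move: T AT; apply/commutantS/commutantS.
Qed.

End Adjoint.

(** * Pinchings *)

Section Pinching.
Variables (R : realType) (X I : choiceType) (c : X -> I).
Local Notation C := R[i].
Implicit Types (f g h : ell2 R X) (a k : C) (x y : X) (i : I).
Variables (T : ell2 R X -> ell2 R X) (bT : bounded_op T).

Lemma esum_fibers (u : X -> \bar R) : (forall x, (0 <= u x)%E) ->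
  (\esum_(x in [set: X]) u x =
   \esum_(i in [set: I]) \esum_(x in c @^-1` [set i]) u x)%E.
Proof.
move=> u0; rewrite esum_esum//.
rewrite (reindex_esum ([set: I] `*`` (fun i => c @^-1` [set i])) [set: X] snd)//.
split=> //.
  by move=> [i x] [j y] /[!inE] -[_ /= <-] [_ /= <-] ->.
by move=> x _; exists (c x, x).
Qed.

Lemma bounded_sqsum : exists2 k : R, 0 <= k &
  forall f, (sqsum (T f) <= k%:E * sqsum f)%E.
Proof.
have [_ [k k0 Tk]] := (bounded_opP T).1 bT.
have [K K0 kK] := ge0_complexP k0.
exists (K ^+ 2); first exact: sqr_ge0.
move=> f; rewrite -!sqr_ell2_norm -EFinM lee_fin -exprMn.
rewrite ler_pXn2r ?nnegrE ?mulr_ge0 ?ell2_norm_ge0//.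
by rewrite -lecR rmorphM /= -kK; exact: Tk.
Qed.

Definition pinch_fun f : X -> C^o := fun x => T (restr (c @^-1` [set c x]) f) x.

(** On each fiber the pinching agrees with T applied to the part of f living there; the bound for T
    then adds up over the disjoint fibers. *)
Lemma sqsum_pinch : exists2 k : R, 0 <= k &
  forall f, (sqsum (pinch_fun f) <= k%:E * sqsum f)%E.
Proof.
have [k k0 Tk] := bounded_sqsum; exists k => // f.
have sq0 (u : X -> C^o) x : (0 <= (Normc.normc (u x) ^+ 2)%:E)%E.
  by rewrite lee_fin sqr_ge0.
rewrite /sqsum (esum_fibers (sq0 f)) (esum_fibers (sq0 (pinch_fun f))).
have fE i : (\esum_(x in c @^-1` [set i]) (Normc.normc (f x) ^+ 2)%:E)%E =
    (ell2_norm (restr (c @^-1` [set i]) f) ^+ 2)%:E.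
  rewrite sqr_ell2_norm /sqsum esum_mkcond; apply: eq_esum => x _.
  by rewrite restrE; case: ifP => // _; rewrite Normc.normc0 expr0n.
under [X in (_ <= _ * X)%E]eq_esum do rewrite fE.
apply: le_trans (le_esumZ _ _) => //; last by move=> i; exact: sqr_ge0.
apply: le_esum => i _; rewrite EFinM sqr_ell2_norm.
apply: le_trans (Tk _); rewrite esum_mkcond; apply: le_esum => x _.
case: ifPn => [/set_mem /= ci|_]; last exact: sq0.
by rewrite /pinch_fun ci.
Qed.

Fact pinch_subproof f : pinch_fun f \in @sqsummable R X.
Proof.
have [k k0 Tk] := sqsum_pinch; apply: le_lt_trans (Tk f) _.
by rewrite -sqr_ell2_norm -EFinM ltry.
Qed.

(* the block-diagonal part [\sum_i P_i T P_i] of [T], [P_i] being the restriction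
   to the fiber of [c] over [i] *)
Definition pinch f : ell2 R X := Ell2 (pinch_subproof f).

Lemma pinchE f x : pinch f x = T (restr (c @^-1` [set c x]) f) x.
Proof. by []. Qed.

Lemma pinch_bounded : bounded_op pinch.
Proof.
apply/bounded_opP; split.
  move=> a f g; apply: ell2_ext => x.
  by rewrite ell2DE ell2ZE !pinchE restr_linear bopDZ.
have [k k0 Tk] := sqsum_pinch.
exists (Num.sqrt k)%:C%C; first by rewrite ler0c sqrtr_ge0.
move=> f; rewrite !ell2_normE -rmorphM lecR.
rewrite -(@ler_pXn2r _ 2) ?nnegrE ?mulr_ge0 ?sqrtr_ge0 ?ell2_norm_ge0//.
rewrite exprMn (sqr_sqrtr k0) -lee_fin (EFinM k) !sqr_ell2_norm; exact: Tk.
Qed.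

Lemma pinch_commute f : (forall i, T \o restr (c @^-1` [set i]) =
  restr (c @^-1` [set i]) \o T) -> pinch f = T f.
Proof.
move=> cT; apply: ell2_ext => x; rewrite pinchE.
have /(congr1 (fun u : ell2 R X -> ell2 R X => u f x))/= -> := cT (c x).
by rewrite ifT// inE.
Qed.

Lemma inner_pinch_finite f (J : {fset X}) : (forall x, x \notin J -> f x = 0) ->
  inner (pinch f) f = \sum_(i <- (c @` J)%fset)
    inner (T (restr (c @^-1` [set i]) f)) (restr (c @^-1` [set i]) f).
Proof.
move=> f0; rewrite (@inner_finite _ _ _ _ J) => [|x xJ]; last first.
  by rewrite f0// conjC0 mulr0.
rewrite (partition_big_imfset _ c); apply: eq_bigr => i _.
rewrite (@inner_finite _ _ _ _ J) => [|x xJ]; last first.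
  by rewrite restrE f0// if_same conjC0 mulr0.
rewrite big_mkcond; apply: eq_bigr => x _.
rewrite pinchE [in RHS]restrE; case: eqVneq => [<-|cx]; first by rewrite ifT// inE.
by rewrite ifF ?conjC0 ?mulr0//; apply: memNset => /= /eqP; apply/negP.
Qed.

(* For finitely supported [f], [inner (pinch f) f] is a finite sum of terms
   [inner (T g) g]; conclude by approximation. *)
Lemma pinch_positive : positive_op T -> positive_op pinch.
Proof.
move=> T0 f; have [_ [k k0 Ek]] := (bounded_opP pinch).1 pinch_bounded.
set z := inner _ _.
have close (e : C) : 0 < e -> exists2 w : C, 0 <= w & `|z - w| <= e.
  (* Replacing f by its truncation in each argument costs at most k |f| d, in total 2 k |f| d <= e;
     the added 1 avoids a zero denominator. *)
  move=> e0; pose d := e / (2 * k * `|f| + 1).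
  have d0 : 0 < d by rewrite divr_gt0// ltr_wpDl// !mulr_ge0.
  have [J lJ] := finite_approx f d0; set g := restr _ f in lJ.
  exists (inner (pinch g) g).
    rewrite (@inner_pinch_finite _ J) => [|x /negbTE xJ]; last first.
      by rewrite restrE mem_setE xJ.
    by apply: sumr_ge0 => i _; exact: T0.
  have -> : z - inner (pinch g) g = inner (pinch f) (f - g) + inner (pinch (f - g)) g.
    by rewrite (bopB pinch_bounded) innerBr innerBl addrA subrK.
  have le1 : `|inner (pinch f) (f - g)| <= k * `|f| * d.
    by rewrite (le_trans (cauchy_schwarz _ _))// ler_pM// ltW.
  have le2 : `|inner (pinch (f - g)) g| <= k * d * `|f|.
    apply: le_trans (cauchy_schwarz _ _) _.
    apply: ler_pM; [by []|by []| |exact: ler_restr].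
    by apply: le_trans (Ek _) _; apply: ler_wpM2l => //; exact: ltW.
  apply: le_trans (ler_normD _ _) _; apply: le_trans (lerD le1 le2) _.
  have -> : k * `|f| * d + k * d * `|f| = (2 * k * `|f|) * d by ring.
  rewrite /d mulrA ler_pdivrMr ?ltr_wpDl ?mulr_ge0// mulrC ler_wpM2l ?ltW//.
  by rewrite ltrDl.
move: z close => [u v] close; rewrite lecE /=.
(* A number within e of a nonnegative real has imaginary part at most e in modulus and real part at
   least -e. *)
have close' (e : R) : 0 < e -> `|v| <= e /\ - e <= u.
  move=> e0; have e0' : 0 < e%:C%C by rewrite ltcE /= eqxx.
  have [[u' v']] := close _ e0'.
  rewrite lecE /= => /andP[/eqP -> u'0].
  rewrite normr_complexE lecR /= oppr0 addr0 => le_e; split.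
    apply: le_trans le_e; rewrite -[X in X <= _]sqrtr_sqr ler_sqrt ?addr_ge0 ?sqr_ge0//.
    by rewrite lerDr sqr_ge0.
  have : `|u - u'| <= e.
    apply: le_trans le_e; rewrite -[X in X <= _]sqrtr_sqr ler_sqrt ?addr_ge0 ?sqr_ge0//.
    by rewrite lerDl sqr_ge0.
  by rewrite ler_norml => /andP[+ _]; lra.
apply/andP; split.
  rewrite -normr_le0; apply/ler_addgt0Pl => e e0; rewrite addr0.
  by have [] := close' e e0.
by rewrite -oppr_le0; apply/ler_addgt0Pl => e /close'[_]; lra.
Qed.

End Pinching.

(** * Group von Neumann algebras *)

Section GroupOperators.
Variables (R : realType) (G : groupType).
Local Notation C := R[i].
Local Notation op := (ell2 R G -> ell2 R G).
Implicit Types (f : ell2 R G) (g a b x y : G) (K S : set G) (T : op).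

Lemma lambdaE g f x : lambda_op R g f x = f (g^-1 * x)%g.
Proof. by []. Qed.

Definition rho_op g : op := precomp (@mulIg G g).

Lemma rhoE g f x : rho_op g f x = f (x * g)%g.
Proof. by []. Qed.

Lemma precomp_linear (s : G -> G) (sI : injective s) : linear (@precomp R G s sI).
Proof. by move=> a f h; apply: ell2_ext => x. Qed.

Lemma norm_precomp (s : G -> G) (sI : injective s) f : bijective s ->
  `|@precomp R G s sI f| = `|f|.
Proof.
move=> sB; apply/eqP; rewrite -(@eqrXn2 _ 2)// -!innerff; apply/eqP.
exact: inner_bij sB _.
Qed.

Lemma precomp_bounded (s : G -> G) (sI : injective s) : bijective s ->
  bounded_op (@precomp R G s sI).
Proof.
move=> sB; apply/bounded_opP; split; first exact: precomp_linear.
by exists 1 => // f; rewrite mul1r norm_precomp.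
Qed.

Lemma bij_mulg g : bijective (fun x => g * x)%g.
Proof. by exists (fun x => g^-1 * x)%g => x; rewrite ?mulKg ?mulVKg. Qed.

Lemma bij_mulgr g : bijective (fun x => x * g)%g.
Proof. by exists (fun x => x * g^-1)%g => x; rewrite ?mulgK ?mulgVK. Qed.

Lemma lambda_bounded g : bounded_op (lambda_op R g).
Proof. exact/precomp_bounded/bij_mulg. Qed.

Lemma rho_bounded g : bounded_op (rho_op g).
Proof. exact/precomp_bounded/bij_mulgr. Qed.

Lemma lambda_delta g x : lambda_op R g (delta R x) = delta R (g * x)%g.
Proof.
by apply: ell2_ext => y; rewrite lambdaE /= -(inj_eq (mulgI g)) mulVKg.
Qed.

Lemma rho_delta g x : rho_op g (delta R x) = delta R (x * g^-1)%g.
Proof.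
by apply: ell2_ext => y; rewrite rhoE /= -(inj_eq (mulIg g^-1%g)) mulgK.
Qed.

Lemma lambdaM g a f : lambda_op R (g * a)%g f = lambda_op R g (lambda_op R a f).
Proof. by apply: ell2_ext => x; rewrite !lambdaE invgM mulgA. Qed.

Lemma lambda1 f : lambda_op R 1%g f = f.
Proof. by apply: ell2_ext => x; rewrite lambdaE invg1 mul1g. Qed.

Lemma adj_lambda g : adj (lambda_op R g) = lambda_op R g^-1%g.
Proof.
apply: eq_adj; first exact: lambda_bounded.
move=> f h; apply: (@inner_bij _ _ _ _ _ _ (fun x => g^-1 * x)%g) => [|x].
  exact: bij_mulg.
by rewrite !lambdaE invgK mulVKg.
Qed.

Definition lambdas S : set op := [set lambda_op R s | s in S].

Lemma lambdas_bounded S : lambdas S `<=` @bounded_op R G.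
Proof. by move=> _ [s _ <-]; exact: lambda_bounded. Qed.

Lemma rho_commutant S g : commutant (lambdas S) (rho_op g).
Proof.
split=> [|_ [s _ <-]]; first exact: rho_bounded.
by apply/funext => f; apply: ell2_ext => x; rewrite /= mulgA.
Qed.

Lemma restr_bounded (D : set G) : bounded_op (@restr R G D).
Proof.
apply/bounded_opP; split; first exact: restr_linear.
by exists 1 => // f; rewrite mul1r ler_restr.
Qed.

Lemma restr_commutant S (D : set G) :
  (forall s x, S s -> D (s^-1 * x)%g <-> D x) -> commutant (lambdas S) (@restr R G D).
Proof.
move=> SD; split=> [|_ [s Ss <-]]; first exact: restr_bounded.
apply/funext => f; apply: ell2_ext => x /=.
rewrite /=; congr (if _ then _ else _).
by apply/idP/idP => /set_mem /(SD _ _ Ss)/mem_set.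
Qed.

Section Subgroup.
Variables (K : set G) (gK : group_closed (mem K)).

Lemma subg1 : K 1%g.
Proof. by apply: set_mem; case: gK. Qed.

Lemma subgV x : K x -> K x^-1%g.
Proof. by move=> /mem_set/(group_closedV gK)/set_mem. Qed.

Lemma subgM x y : K x -> K y -> K (x * y)%g.
Proof. by move=> /mem_set + /mem_set; move=> /(group_closedM gK)/[apply]/set_mem. Qed.

Lemma subgMl x y : K x -> K (x * y)%g <-> K y.
Proof.
move=> Kx; split=> [Kxy|]; last exact: subgM.
by rewrite -[y](mulKg x); apply: subgM => //; exact: subgV.
Qed.

Lemma group_vnaE : group_vna R K = commutant (commutant (lambdas K)).
Proof.
apply: vn_generatedE; first exact: lambdas_bounded.
by move=> _ [s Ks <-]; rewrite adj_lambda; exists s^-1%g => //; exact: subgV.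
Qed.

Lemma lambda_vna g : K g -> group_vna R K (lambda_op R g).
Proof.
move=> Kg; rewrite group_vnaE; apply: sub_bicommutant; last by exists g.
exact: lambdas_bounded.
Qed.

Lemma vna_bounded T : group_vna R K T -> bounded_op T.
Proof. by rewrite group_vnaE => -[]. Qed.

Lemma vna_comp T T' : group_vna R K T -> group_vna R K T' -> group_vna R K (T \o T').
Proof.
rewrite group_vnaE => -[bT cT] [bT' cT']; split; first exact: bounded_comp.
by move=> s cs; rewrite -compA cT'// compA cT// compA.
Qed.

Lemma vna_commute T s f : group_vna R K T -> commutant (lambdas K) s ->
  T (s f) = s (T f).
Proof.
rewrite group_vnaE => -[bT cT] /cT/(congr1 (fun u : op => u f))/= //.
Qed.

(** T commutes with right translations, so its matrix depends only on x g^-1 and its first column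
    determines it. *)
Lemma vna_delta T g x : group_vna R K T ->
  T (delta R g) x = T (delta R 1%g) (x * g^-1)%g.
Proof.
move=> KT; have := vna_commute (delta R 1%g) KT (rho_commutant K g^-1%g).
by rewrite rho_delta invgK mul1g => ->; rewrite rhoE.
Qed.

(** The projection onto l^2(K) commutes with [lambdas K] and fixes delta_e, hence it fixes T
    delta_e. *)
Lemma vna_supp T x : group_vna R K T -> ~ K x -> T (delta R 1%g) x = 0.
Proof.
move=> KT Kx; have rK : commutant (lambdas K) (@restr R G K).
  by apply: restr_commutant => s y Ks; apply/subgMl/subgV.
have := vna_commute (delta R 1%g) KT rK.
rewrite restr_delta ?restrE; last exact/mem_set/subg1.
by move=> ->; rewrite restrE memNset.
Qed.

Lemma eq_vna T T' : group_vna R K T -> group_vna R K T' ->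
  T (delta R 1%g) = T' (delta R 1%g) -> T = T'.
Proof.
move=> KT KT' TT'; apply: eq_bounded_op; [exact: vna_bounded..|] => x y.
by rewrite (vna_delta _ _ KT) (vna_delta _ _ KT') TT'.
Qed.

End Subgroup.

Lemma vna_sub S K : S `<=` K -> group_vna R S `<=` group_vna R K.
Proof.
move=> SK T ST A vA KA; apply: ST => //.
by move=> _ [s Ss <-]; apply: KA; exists s => //; exact: SK.
Qed.

Lemma group_closedT : group_closed (mem [set: G]).
Proof. by split=> [|x y _ _]; exact: mem_set. Qed.

End GroupOperators.

(** * The conditional expectation of L(G) onto L(K) *)

Section ConditionalExpectation.
Variables (R : realType) (G : groupType).
Local Notation C := R[i].
Local Notation op := (ell2 R G -> ell2 R G).
Local Notation tau := (canonical_trace R G).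
Local Notation M := (group_vna R [set: G]).
Local Notation d1 := (delta R (1%g : G)).
Implicit Types (f : ell2 R G) (g a b x y : G) (T : op).

Let groupT := group_closedT G.

Lemma canonical_traceE T : tau T = T d1 1%g.
Proof. exact: innerDelta. Qed.

Lemma norm2E T : bounded_op T -> norm2 tau T = ell2_norm (T d1).
Proof.
move=> bT; rewrite /norm2 /canonical_trace /= adjEl// innerff ell2_normE.
by rewrite -rmorphXn /= sqrtr_sqr ger0_norm// ell2_norm_ge0.
Qed.

Variables (K : set G) (gK : group_closed (mem K)).
Local Notation N := (group_vna R K).

(** The coset K x, serving as the label of x: pinching along this map cuts an operator into blocks
    indexed by K\G. *)
Definition right_coset x : set G := [set y | K (y * x^-1)%g].

Lemma right_cosetP x y : right_coset y = right_coset x <-> K (y * x^-1)%g.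
Proof.
split=> [yx|Kyx].
  have : right_coset y y by rewrite /right_coset /= mulgV; exact: subg1 gK.
  by rewrite yx.
apply/seteqP; split => z; rewrite /right_coset /=.
  by move=> Kzy; rewrite -[z](mulgVK y) -mulgA; apply: (subgM gK).
move=> Kzx; rewrite -[z](mulgVK x) -mulgA; apply: (subgM gK) => //.
by rewrite -[(x * _)%g]invgK invgM invgK; apply: (subgV gK).
Qed.

(* the value on unbounded operators is irrelevant *)
Definition expect (T : op) : op :=
  if pselect (bounded_op T) is left bT then pinch right_coset bT else fun=> 0.

Lemma expectE T f x : bounded_op T ->
  expect T f x = T (restr (right_coset @^-1` [set right_coset x]) f) x.
Proof. by rewrite /expect; case: pselect. Qed.

Lemma expect_bounded T : bounded_op T -> bounded_op (expect T).
Proof. by rewrite /expect; case: pselect => // bT _; exact: pinch_bounded. Qed.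

Lemma restr_coset_commutant (i : set G) :
  commutant (@lambdas R G K) (@restr R G (right_coset @^-1` [set i])).
Proof.
apply: restr_commutant => s x Ks /=.
suff -> : right_coset (s^-1 * x)%g = right_coset x by [].
by apply/right_cosetP; rewrite mulgK; exact: (subgV gK).
Qed.

Lemma expect_id T : N T -> expect T = T.
Proof.
move=> NT; apply/funext => f; rewrite /expect.
case: pselect => [bT|[]]; last exact: (vna_bounded gK).
apply: pinch_commute => i; apply/funext => h /=.
by rewrite (vna_commute gK)//; exact: restr_coset_commutant.
Qed.

(* With [T delta_e = \sum_k c_k delta_k] and [S] commuting with [lambda K], both
   sides take the value [\sum_(k in K) c_k * S delta_a (k^-1 b)]; the summation
   variable is [x = k a] on one side and [k^-1 b = a x^-1 b] on the other. *)
Lemma expect_vna T : M T -> N (expect T).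
Proof.
move=> MT; have bT := vna_bounded groupT MT.
have bE := expect_bounded bT.
rewrite (group_vnaE _ gK); split=> // S [bS cS].
apply: eq_bounded_op => [||a b] /=; [exact: bounded_comp..|].
rewrite expectE// -!innerDelta (adjE _ _ bS) (adjE _ _ bT).
apply/esym; apply: (@inner_bij _ _ _ _ _ _ (fun x => a * x^-1 * b)%g)
  => [|x].
  exists (fun x => b * x^-1 * a)%g => x; rewrite !invgM invgK !mulgA.
    by rewrite mulgV mul1g mulgVK.
  by rewrite mulgV mul1g mulgVK.
rewrite expectE// -![adj _ _ _]innerDelta !adjEl// !innerDeltal !conjCK.
rewrite restrE.
have -> : (a * x^-1 * b)%g \in right_coset @^-1` [set right_coset b] =
    (a \in right_coset @^-1` [set right_coset x]) :> bool.
  by apply/idP/idP => /set_mem/right_cosetP h; apply/mem_set/right_cosetP;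
    move: h; rewrite mulgK.
case: (boolP (a \in _)) => [axK|axK]; last first.
  rewrite mul0r.
  suff -> : restr (right_coset @^-1` [set right_coset x]) (delta R a) = 0.
    by rewrite bop0// mul0r.
  apply: ell2_ext => y; rewrite restrE /=; case: ifP => // yK.
  by case: eqVneq axK => // <-; rewrite yK.
rewrite restr_delta// mulrC (vna_delta groupT a x MT).
rewrite (vna_delta groupT (a * x^-1 * b)%g b MT); congr (_ * _); last first.
  by congr (T _ _); rewrite !invgM invgK !mulgA mulgV mul1g.
have Kxa : K (x * a^-1)%g.
  rewrite -[(x * _)%g]invgK invgM invgK; apply: (subgV gK).
  by apply/right_cosetP; exact: set_mem axK.
have /cS/(congr1 (fun u : op => u (delta R a) b))/= :
    lambdas K (lambda_op R (x * a^-1)%g).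
  by exists (x * a^-1)%g.
rewrite lambda_delta mulgVK => ->.
by congr (S _ _); rewrite invgM invgK.
Qed.

Lemma expect_delta T : bounded_op T -> expect T d1 1%g = T d1 1%g.
Proof.
move=> bT; rewrite expectE// restr_delta//; exact/mem_set.
Qed.

(** Elements of N commute with the coset projections, whence the bimodule property; the trace is a
    diagonal entry, which a pinching keeps. *)
Lemma is_condexp_expect : is_condexp tau M N expect.
Proof.
have bM T : M T -> bounded_op T by exact: (vna_bounded groupT).
have NM : N `<=` M by exact: vna_sub.
split=> //.
- exact: expect_vna.
- move=> a T T' MT MT'; apply/funext => f; apply: ell2_ext => x.
  have bTT' : bounded_op (a *: T + T').
    apply/bounded_opP; split.
      move=> k u v; rewrite [LHS]/(a *: T (k *: u + v) + T' (k *: u + v)).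
      rewrite [RHS]/(k *: (a *: T u + T' u) + (a *: T v + T' v)).
      rewrite (bopDZ (bM _ MT)) (bopDZ (bM _ MT')) !scalerDr !scalerA (mulrC a).
      exact: addrACA.
    have [_ [k k0 Tk]] := (bounded_opP T).1 (bM _ MT).
    have [_ [k' k'0 Tk']] := (bounded_opP T').1 (bM _ MT').
    exists (`|a| * k + k') => [|u]; first by rewrite addr_ge0 ?mulr_ge0.
    rewrite [(a *: T + T') u]/(a *: T u + T' u) (le_trans (ler_normD _ _))//.
    by rewrite mulrDl lerD// normrZ -mulrA ler_wpM2l.
  rewrite [RHS]/(a * (expect T f x : C) + expect T' f x) !expectE//; exact: bM.
- exact: expect_id.
- move=> a b T Na Nb MT; apply/funext => f; apply: ell2_ext => x.
  have [ba bb bT] : [/\ bounded_op a, bounded_op b & bounded_op T].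
    by split; apply: bM => //; exact: NM.
  have bab : bounded_op (a \o T \o b) by do 2!apply: bounded_comp => //.
  have cr := restr_coset_commutant (right_coset x).
  rewrite expectE//= (vna_commute gK _ Nb cr).
  (* As a commutes with the coset projections, its value at x depends only on the part of u on the
     coset of x. *)
  have aE u : a u x = a (restr (right_coset @^-1` [set right_coset x]) u) x.
    by rewrite (vna_commute gK _ Na cr) restrE ifT// inE.
  rewrite aE [RHS]aE; congr (a _ x); apply: ell2_ext => y; rewrite !restrE.
  by case: ifP => // /set_mem/= yx; rewrite expectE// yx.
- split=> T MT; last by rewrite !canonical_traceE expect_delta//; exact: bM.
  move=> T0; rewrite /expect; case: pselect => [bT|nbT]; last by case: nbT; exact: bM.
  exact: (@pinch_positive _ _ _ _ _ bT T0).
Qed.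

Local Notation E := (condexp tau M N).

Lemma is_condexp_condexp : is_condexp tau M N E.
Proof. exact: (xgetPex (fun x : op => x) (ex_intro _ expect is_condexp_expect)). Qed.

Lemma condexp_vna T : M T -> N (E T).
Proof. by case: is_condexp_condexp => + _ _ _ _; apply. Qed.

(** This uses the axioms of a conditional expectation only, so it holds for the one selected by
    [condexp]: for y in K the coordinate at y is the trace of lambda_y^* (E T), which equals that of
    lambda_y^* T by bimodularity and invariance of the trace. *)
Lemma condexp_delta T : M T -> E T d1 = restr K (T d1).
Proof.
move=> MT; have [EN _ _ Ebim [_ Etau]] := is_condexp_condexp.
apply: ell2_ext => y; rewrite restrE; case: ifPn => [/set_mem Ky|/negP Ky]; last first.
  by apply: (vna_supp gK) => [|/mem_set]; [exact: EN|].
have Kl g : K g -> N (lambda_op R g) by exact: lambda_vna.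
(* The right factor lambda_e fits the two-sided form of the bimodule axiom. *)
have lE S : tau (lambda_op R y^-1%g \o S \o lambda_op R 1%g) = S d1 y.
  by rewrite canonical_traceE /= !lambda1 invgK mulg1.
rewrite -(lE (E T)) -Ebim//; last 2 first.
- by apply: Kl; exact: (subgV gK).
- by apply: Kl; exact: (subg1 gK).
rewrite Etau ?lE//; apply: (vna_comp groupT); last exact: lambda_vna.
by apply: (vna_comp groupT) => //; exact: lambda_vna.
Qed.

(** An element of M is determined by its value at delta_e, so E T = 0 can be tested there. *)
Lemma ominusP T : ominus tau M N T <-> M T /\ forall x, K x -> T d1 x = 0.
Proof.
split=> [[MT ET]|[MT TK]]; split=> //.
  move=> x Kx; have := condexp_delta MT.
  rewrite ET => /(congr1 (fun f : ell2 R G => f x)).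
  by rewrite restrE mem_set.
apply: (eq_vna groupT).
- by apply: (@vna_sub _ _ K) => //; exact: condexp_vna.
- apply: (@vna_sub _ _ K) => //; rewrite (group_vnaE _ gK); split; last first.
    by move=> s [bs _]; apply/funext => f /=; rewrite (bop0 bs).
  apply/bounded_opP; split=> [a f h|]; first by rewrite scaler0 addr0.
  by exists 0 => // f; rewrite normr0 mul0r.
rewrite (condexp_delta MT); apply: ell2_ext => x; rewrite restrE.
by case: ifP => // /set_mem/TK.
Qed.

Lemma norm2_condexp T : M T -> norm2 tau (E T) = ell2_norm (restr K (T d1)).
Proof.
move=> MT; rewrite norm2E ?condexp_delta//.
by apply: (vna_bounded gK); exact: condexp_vna.
Qed.

End ConditionalExpectation.

(** * The equivalences *)

Lemma tails_filter (I : Type) (le : I -> I -> Prop) :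
  directed le -> ProperFilter (tails le).
Proof.
move=> [[i0] refl trans dir]; apply: filter_from_proper => [|i _]; last first.
  by exists i; exact: refl.
apply: filter_from_filter => [|i j _ _]; first by exists i0.
have [k [ik jk]] := dir i j; exists k => // l kl.
by split; [exact: trans kl|exact: trans kl].
Qed.

(** * Moving points with infinite orbits off a finite set *)

Section Covering.
Variables (G : groupType) (H : set G) (gH : group_closed (mem H)).
Variables (X : choiceType) (act : G -> X -> X).
Hypothesis act1 : forall p, act 1%g p = p.
Hypothesis actM : forall g h p, act (g * h)%g p = act g (act h p).

(* P. M. Neumann's separation lemma, by induction on [P] after Birch, Burns,
   Macdonald and Neumann: if [act h0 p] avoids [Q] and [act h p] lies in [Q], say
   [act h p = act m (act h0 p)], then [m^-1 h] sends a point of [P] other than [p]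
   into [Q]. *)
Lemma neumann_separation (P : seq X) (Q : set X) : finite_set Q ->
  (forall p, p \in P -> ~ finite_set [set act h p | h in H]) ->
  exists2 h, H h & forall p, p \in P -> ~ Q (act h p).
Proof.
elim: P Q => [|p P IH] Q finQ infP; first by exists 1%g => //; exact: subg1 gH.
apply: contrapT => none.
have cover h : H h -> exists2 q, q \in p :: P & Q (act h q).
  move=> Hh; apply: contrapT => nq; apply: none; exists h => // q qP Qq.
  by apply: nq; exists q.
have [h0 Hh0 Qh0] : exists2 h0, H h0 & ~ Q (act h0 p).
  apply: contrapT => all; apply: (infP p (mem_head _ _)).
  apply: sub_finite_set finQ => _ [h Hh <-].
  by apply: contrapT => Qh; apply: all; exists h.
have /choice[m mP] q : exists m, (H m /\ act m (act h0 p) = q) \/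
    ~ exists2 m, H m & act m (act h0 p) = q.
  case: (pselect (exists2 m, H m & act m (act h0 p) = q)) => [[m Hm mq]|nm].
    by exists m; left.
  by exists 1%g; right.
(* An h moving P off this larger set moves it off Q, and so does each (m q)^-1 h with q in Q. The
   value 1 of m at unreachable q adds only Q itself. *)
have finQ' : finite_set (Q `|` \bigcup_(q in Q) (act (m q) @` Q)).
  rewrite finite_setU; split=> //; apply: bigcup_finite => // q _.
  exact: finite_image.
have infP' q : q \in P -> ~ finite_set [set act h q | h in H].
  by move=> qP; apply: infP; rewrite inE qP orbT.
have [h Hh hP] := IH _ finQ' infP'.
have [q qP Qq] := cover h Hh.
have Pq r : r \in p :: P -> Q (act h r) -> r = p.
  by rewrite inE => /orP[/eqP//|/hP nQ Qr]; case: nQ; left.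
move: (Qq); rewrite (Pq q qP Qq) => Qp.
case: (mP (act h p)) => [[Hm mE]|[]]; last first.
  exists (h * h0^-1)%g; first by apply: (subgM gH) => //; exact: (subgV gH).
  by rewrite -actM mulgVK.
set m' := m (act h p) in Hm mE.
have Hmh : H (m'^-1 * h)%g.
  by apply: (subgM gH) => //; exact: (subgV gH).
have [r rP Qr] := cover _ Hmh.
move: rP; rewrite inE => /orP[/eqP rp|rP].
  by apply: Qh0; rewrite rp actM -mE -actM mulVg act1 in Qr.
apply: (hP r rP); right; exists (act h p) => //.
exists (act (m'^-1 * h)%g r) => //.
by rewrite -actM mulVKg.
Qed.

End Covering.

(** * Vectors on G/H: (3) => (4) => (5) => (6) *)

Section Implications.
Variables (R : realType) (G : groupType) (H K : set G).
Hypotheses (gH : group_closed (mem H)) (gK : group_closed (mem K)).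
Hypothesis subHK : H `<=` K.
Local Notation C := R[i].
Local Notation op := (ell2 R G -> ell2 R G).
Local Notation tau := (canonical_trace R G).
Local Notation B := (group_vna R H).
Local Notation N := (group_vna R K).
Local Notation M := (group_vna R [set: G]).
Local Notation d1 := (delta R (1%g : G)).
Local Notation X := (left_cosets H).

Let groupT := group_closedT G.

Lemma lambda_unitary g : H g -> unitaries B (lambda_op R g).
Proof.
move=> Hg; split; first exact: lambda_vna.
  by apply/funext => f; rewrite adj_lambda /comp -lambdaM mulVg lambda1.
by apply/funext => f; rewrite adj_lambda /comp -lambdaM mulgV lambda1.
Qed.

Lemma lambda_ominus g : ~ K g -> ominus tau M N (lambda_op R g).
Proof.
move=> Kg; apply/(ominusP gK); split; first exact: lambda_vna.
move=> x Kx; rewrite lambda_delta mulg1 /=.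
by case: eqVneq => // xg; rewrite xg in Kx.
Qed.

Lemma coset_translate1 (a : X) : coset_translate 1%g a = a.
Proof.
apply/val_inj/seteqP; split=> [_ [x ax <-]|x ax]; first by rewrite mul1g.
by exists x => //; rewrite mul1g.
Qed.

Lemma coset_translateM g h (a : X) :
  coset_translate (g * h)%g a = coset_translate g (coset_translate h a).
Proof.
apply/val_inj; rewrite /= image_comp; apply/seteqP.
by split=> _ [x ax <-]; exists x => //=; rewrite mulgA.
Qed.

Lemma coset_translateK g : cancel (@coset_translate G H g) (coset_translate g^-1%g).
Proof. by move=> a; rewrite -coset_translateM mulVg coset_translate1. Qed.

Definition coset g : X :=
  exist _ (left_coset H g) (mem_set (ex_intro2 _ _ g Logic.I erefl)).

Lemma cosetP (a : X) : exists g, a = coset g.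
Proof. by case: a => a aP; have [g _ ag] := set_mem aP; exists g; apply/val_inj. Qed.

Lemma coset_translate_coset g h : coset_translate g (coset h) = coset (g * h)%g.
Proof.
apply/val_inj; rewrite /= /left_coset image_comp; apply/seteqP.
by split=> _ [x ax <-]; exists x => //=; rewrite mulgA.
Qed.

Lemma eq_coset g h : coset g = coset h <-> H (h^-1 * g)%g.
Proof.
split=> [/(congr1 val)/= gh|Hhg].
  have : left_coset H g g by exists 1%g; [exact: subg1 gH|rewrite mulg1].
  by rewrite gh => -[x Hx <-]; rewrite mulKg.
apply/val_inj/seteqP; split=> _ [x Hx <-] /=.
  by exists (h^-1 * g * x)%g; [exact: (subgM gH)|rewrite -!mulgA mulVKg].
exists (g^-1 * h * x)%g; last by rewrite -!mulgA mulVKg.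
apply: (subgM gH) => //; rewrite -[(g^-1 * h)%g]invgK invgM invgK.
exact: (subgV gH).
Qed.

Lemma quasi_regularE g (xi : ell2 R X) a :
  quasi_regular g xi a = xi (coset_translate g^-1%g a).
Proof. by []. Qed.

Lemma supported_inP (xi : ell2 R X) :
  supported_in R H K xi <-> forall g, ~ K g -> xi (coset g) = 0.
Proof.
split=> [sxi g Kg|sxi a aK].
  apply: sxi => -[k Kk gk].
  have /eq_coset Hkg : coset g = coset k by exact: val_inj.
  by apply: Kg; rewrite -[g](mulVKg k); apply: (subgM gK) => //; exact: subHK.
have [g ag] := cosetP a; rewrite ag; apply: sxi => Kg.
by apply: aK; exists g => //; rewrite ag.
Qed.


Lemma infinite_orbit g : invariant_vectors R H `<=` supported_in R H K -> ~ K g ->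
  ~ finite_set [set coset_translate h (coset g) | h in H].
Proof.
move=> inv Kg finO; set O := (X in finite_set X) in finO.
(* The indicator function of the orbit, written as a sum of basis vectors so that it is an element
   of l^2 by construction. *)
pose xi : ell2 R X := \sum_(a <- fset_set O) 1 *: delta R a.
have xiE a : xi a = if a \in O then 1 else 0.
  by rewrite /xi (sum_deltaE (fun=> 1)) in_fset_set.
have OV h a : H h -> O a -> O (coset_translate h a).
  move=> Hh [h' Hh' <-]; exists (h * h')%g; first exact: (subgM gH).
  by rewrite coset_translateM.
have : supported_in R H K xi.
  apply: inv => h Hh; apply: ell2_ext => a; rewrite quasi_regularE !xiE.
  congr (if _ then _ else _); apply/idP/idP => /set_mem Oa; apply/mem_set.
    by rewrite -(coset_translateK h^-1%g a) invgK; exact: OV.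
  by apply: OV => //; exact: (subgV gH).
move=> /supported_inP/(_ _ Kg)/eqP; rewrite xiE mem_set ?oner_eq0//.
by exists 1%g; [exact: (subg1 gH)|exact: coset_translate1].
Qed.

Lemma separation_of_invariant : invariant_vectors R H `<=` supported_in R H K ->
  forall F : set G, F !=set0 -> finite_set F -> F `<=` ~` K ->
    exists h, H h /\ prodset (prodset F [set h]) F `&` H = set0.
Proof.
move=> inv F _ finF FK.
(* The product f1 h f2 lies in H exactly when h moves the coset f2 H to f1^-1 H. *)
have finQ : finite_set [set coset f^-1%g | f in F] by exact: finite_image.
have inf p : p \in [seq coset f | f <- fset_set F] ->
    ~ finite_set [set coset_translate h p | h in H].
  move=> /mapP[f]; rewrite in_fset_set// => /set_mem Ff ->.
  by apply: infinite_orbit => //; exact: FK.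
have [h Hh hP] := neumann_separation gH coset_translate1 coset_translateM finQ inf.
exists h; split=> //; apply/seteqP; split=> //
  _ [[_ [f1 Ff1 [_ -> <-]]] [f2 Ff2 <-] HH].
apply: (hP (coset f2)); first by apply: map_f; rewrite in_fset_set// mem_set.
exists f1 => //; rewrite coset_translate_coset; apply/esym/eq_coset.
by rewrite invgK mulgA.
Qed.

Lemma invariant_compact : invariant_vectors R H `<=` compact_vectors R H.
Proof.
move=> xi inv; rewrite /compact_vectors /=.
have -> : [set quasi_regular h xi | h in H] = [set xi].
  apply/seteqP; split=> [_ [h Hh <-]|_ ->]; first exact: inv.
  by exists 1%g; [exact: (subg1 gH)|apply: inv; exact: (subg1 gH)].
have <- : [set xi] = closure [set xi].
  apply/closure_id; apply: accessible_closed_set1.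
  by apply: hausdorff_accessible; exact: norm_hausdorff.
exact: compact_set1.
Qed.

Lemma ler_coord (Y : choiceType) (xi : ell2 R Y) a : `|xi a : C| <= `|xi|.
Proof. by rewrite -innerDelta (le_trans (cauchy_schwarz _ _))// norm_delta mulr1. Qed.

(** Off the support of a truncation within e of xi, each coordinate is bounded by the norm of the
    tail. *)
Lemma finite_large (Y : choiceType) (xi : ell2 R Y) (e : C) : 0 < e ->
  finite_set [set a | e <= `|xi a : C|].
Proof.
move=> e0; have [J lJ] := finite_approx xi e0.
apply: (sub_finite_set _ (finite_fset J)) => a /= ea; apply: contrapT => /negP aJ.
have : `|(xi - restr [set` J] xi) a : C| < e.
  exact: le_lt_trans (ler_coord _ _) lJ.
rewrite ell2BE restrE mem_setE (negbTE aJ).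
by rewrite subr0 => /(le_lt_trans ea); rewrite ltxx.
Qed.

Lemma compact_supported : quasi_normalizer1 H `<=` K ->
  compact_vectors R H `<=` supported_in R H K.
Proof.
move=> qK xi cxi; apply/supported_inP => g Kg; apply: contrapT => /eqP xig.
apply: Kg; apply: qK.
set c : C := `|xi (coset g) : C|.
have c0 : 0 < c by rewrite normr_gt0.
have c20 : 0 < c / 2 by rewrite divr_gt0.
move: cxi; rewrite /compact_vectors /= compact_cover.
move=> /(_ _ [set: ell2 R X] (fun p => ball p (c / 2))).
have op p : [set: ell2 R X] p -> open (ball p (c / 2)) by move=> _; exact: ball_open.
move=> /(_ op)[|D _ cov].
  by move=> p _; exists p => //; exact: ballxx.
(* The translate of xi by h has a coordinate of modulus c at h g H, so the center of a ball of
   radius c / 2 containing it has one of modulus at least c / 2 there. All the cosets h g H thus lie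
   in Q, and representatives of Q form the finite set required by [quasi_normalizer1]. *)
pose Q := \bigcup_(p in [set` D]) [set a | c / 2 <= `|p a : C|].
have finQ : finite_set Q.
  by apply: bigcup_finite => [|p _]; [exact: finite_fset|exact: finite_large].
have [r rE] := choice cosetP.
exists (r @` Q); split; first exact: finite_image.
move=> _ [h Hh [_ -> <-]].
have hxi : closure [set quasi_regular h xi | h in H] (quasi_regular h xi).
  by apply: subset_closure; exists h.
have [p pD bp] := cov _ hxi.
have Qhg : Q (coset (h * g)%g).
  exists p => //=; have : `|(p - quasi_regular h xi) (coset (h * g)%g) : C| < c / 2.
    by move: bp; rewrite -ball_normE; apply/le_lt_trans/ler_coord.
  rewrite ell2BE quasi_regularE coset_translate_coset mulKg => lt.
  have : c <= `|p (coset (h * g)%g) : C| + c / 2.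
    rewrite {1}/c -[xi _](subrK (p (coset (h * g)%g) : C)) addrC.
    by rewrite (le_trans (ler_normD _ _))// lerD// distrC ltW.
  by rewrite -lerBlDr {1}(splitr c) addrK.
exists (r (coset (h * g)%g)); first by exists (coset (h * g)%g).
have /eq_coset := rE (coset (h * g)%g).
exists ((r (coset (h * g)%g))^-1 * (h * g))%g => //.
by rewrite mulVKg.
Qed.

End Implications.

(** * Estimates in the 2-norm: (2) => (3) and (6) => (1) *)

Section OperatorImplications.
Variables (R : realType) (G : groupType) (H K : set G).
Hypotheses (gH : group_closed (mem H)) (gK : group_closed (mem K)).
Hypothesis subHK : H `<=` K.
Local Notation C := R[i].
Local Notation op := (ell2 R G -> ell2 R G).
Local Notation tau := (canonical_trace R G).
Local Notation B := (group_vna R H).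
Local Notation N := (group_vna R K).
Local Notation M := (group_vna R [set: G]).
Local Notation d1 := (delta R (1%g : G)).

Let groupT := group_closedT G.

Lemma unitary_sqsum u : unitaries B u -> sqsum (u d1) = 1%E.
Proof.
move=> [Bu uu _]; have bu := vna_bounded gH Bu.
have : `|u d1| ^+ 2 = 1.
  rewrite -innerff -(adjEl _ _ bu) -[adj u (u d1)]/((adj u \o u) d1) uu.
  by rewrite innerff norm_delta expr1n.
rewrite ell2_normE -rmorphXn -sqr_ell2_norm.
by move=> /(@complexI _ _ 1) ->.
Qed.

(** The substitution x -> j^-1 x g carries the coefficients of u delta_e to those of lambda_j^* u
    lambda_g delta_e. As u delta_e lives on H, each of its nonzero coefficients is sent into H by
    some j in J, hence counted on the right. *)
Lemma unitary_translates (J : {fset G}) g u : B u -> (forall h, H h ->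
    exists2 j, j \in J & H (j^-1 * h * g)%g) ->
  (sqsum (u d1) <= \sum_(j <- J)
    sqsum (restr H ((lambda_op R j^-1%g \o u \o lambda_op R g) d1)))%E.
Proof.
move=> Bu cov; set w := fun j => (lambda_op R j^-1%g \o u \o lambda_op R g) d1.
pose s j x := (j^-1 * x * g)%g.
have wE j x : w j (s j x) = u d1 x.
  rewrite /w /s /= lambda_delta invgK !mulgA mulg1 mulgV mul1g.
  by rewrite (vna_delta gH _ _ Bu) mulgK.
have sE j : sqsum (restr H (w j)) =
    (\esum_(x in [set: G]) (Normc.normc (restr H (w j) (s j x)) ^+ 2)%:E)%E.
  rewrite /sqsum (reindex_esum [set: G] _ (s j))//; split=> //.
    by move=> x y _ _; rewrite /s => /mulIg/mulgI.
  by move=> y _; exists (j * y * g^-1)%g; rewrite // /s !mulgA mulVg mul1g mulgVK.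
rewrite (eq_bigr _ (fun j _ => sE j)) -esum_sum; last first.
  by move=> x j _ _; rewrite lee_fin sqr_ge0.
apply: le_esum => x _; case: (pselect (H x)) => [Hx|Hx]; last first.
  rewrite (vna_supp gH Bu Hx) Normc.normc0 expr0n /=.
  by apply: sume_ge0 => j _; rewrite lee_fin sqr_ge0.
have [j jJ Hj] := cov _ Hx.
rewrite (big_fsetD1 j)// restrE wE ifT; last exact: mem_set.
rewrite leeDl//; apply: sume_ge0 => i _; rewrite lee_fin; exact: sqr_ge0.
Qed.

Lemma quasi_normalizer_of_wahp : relative_wahp tau B N M -> quasi_normalizer1 H `<=` K.
Proof.
move=> [I [le [u [dir uB lim]]]] g [F [finF HgF]]; apply: contrapT => Kg.
have PF := tails_filter dir.
pose J := fset_set (F `&` ~` K).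
have finJ : finite_set (F `&` ~` K) by apply: finite_setI; left.
have JP j : j \in J -> ~ K j by rewrite in_fset_set// => /set_mem[].
have cov h : H h -> exists2 j, j \in J & H (j^-1 * h * g)%g.
  move=> Hh; have [|f Ff [h' Hh' fh]] := HgF (h * g)%g.
    by exists h => //; exists g.
  exists f; last by rewrite -mulgA -fh mulKg.
  rewrite in_fset_set//; apply/mem_set; split=> // Kf; apply: Kg.
  rewrite -[g](mulKg h) -fh; apply: (subgM gK); first exact/(subgV gK)/subHK.
  by apply: (subgM gK) => //; exact: subHK.
pose n j i := norm2 tau (condexp tau M B (lambda_op R j^-1%g \o u i \o lambda_op R g)).
have MT j i : M (lambda_op R j^-1%g \o u i \o lambda_op R g).
  apply: (vna_comp groupT); last exact: lambda_vna.
  apply: (vna_comp groupT); first exact: lambda_vna.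
  by apply: (@vna_sub _ _ H) => //; case: (uB i).
have nE j i : (n j i ^+ 2)%:E =
    sqsum (restr H ((lambda_op R j^-1%g \o u i \o lambda_op R g) d1)).
  by rewrite /n (norm2_condexp gH (MT j i)) sqr_ell2_norm.
have lim0 (s : seq G) : (forall j, j \in s -> ~ K j) ->
    (fun i => \sum_(j <- s) n j i ^+ 2) @ tails le --> (0 : R).
  elim: s => [_|j s IH sK].
    by under eq_fun do rewrite big_nil; exact: cvg_cst.
  have nj : n j @ tails le --> (0 : R).
    apply: lim; last exact: lambda_ominus.
    apply: lambda_ominus => // /(subgV gK); rewrite invgK.
    exact/sK/mem_head.
  have {}IH : (fun i => \sum_(j <- s) n j i ^+ 2) @ tails le --> (0 : R).
    by apply: IH => k ks; apply: sK; rewrite inE ks orbT.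
  have -> : (fun i => \sum_(k <- j :: s) n k i ^+ 2) =
      (n j \* n j) \+ (fun i => \sum_(k <- s) n k i ^+ 2).
    by apply/funext => i; rewrite big_cons expr2.
  suff : ((n j \* n j) \+ (fun i => \sum_(k <- s) n k i ^+ 2)) @ tails le -->
    (0 * 0 + 0 : R) by rewrite mulr0 addr0.
  by apply: cvgD => //; exact: cvgM.
(* At this index the masses on H add up to less than 1, the mass of the unit vector u_i delta_e. *)
have /cvgrPdist_lt/(_ _ ltr01)[i _ /(_ i)] := lim0 J JP.
move=> /(_ (let: And4 _ refl _ _ := dir in refl i)) /=.
rewrite sub0r normrN ger0_norm; last by apply: sumr_ge0 => j _; exact: sqr_ge0.
apply/negP; rewrite -leNgt -lee_fin -sumEFin.
rewrite (eq_bigr _ (fun j _ => nE j i)) -[1%:E](unitary_sqsum (uB i)).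
by apply: unitary_translates => //; case: (uB i).
Qed.

Lemma wahp_of_separation :
  (forall F : set G, F !=set0 -> finite_set F -> F `<=` ~` K ->
    exists h, H h /\ prodset (prodset F [set h]) F `&` H = set0) ->
  exists (I : Type) (le : I -> I -> Prop) (h : I -> G),
    [/\ directed le, (forall i, H (h i)) &
        forall x y, ominus tau M N x -> ominus tau M N y ->
          (fun i => norm2 tau (condexp tau M B (x \o lambda_op R (h i) \o y)))
            @ tails le --> (0 : R)].
Proof.
move=> sep.
have /choice[h hP] (J : {fset G}) : exists h, H h /\ forall a b, a \in J ->
    b \in J -> ~ K a -> ~ K b -> ~ H (a * h * b)%g.
  (* When J is contained in K the requirement is void, and h = e serves. *)
  have [[a aF]|F0] := pselect (([set` J] `&` ~` K) !=set0); last first.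
    exists 1%g; split=> [|a b aJ _ Ka]; first exact: (subg1 gH).
    by case: F0; exists a.
  have finJ : finite_set ([set` J] `&` ~` K).
    by apply: finite_setI; left; exact: finite_fset.
  have JK : [set` J] `&` ~` K `<=` ~` K by move=> ? [].
  have [h [Hh hJ]] := sep _ (ex_intro _ a aF) finJ JK.
  exists h; split=> // b c bJ cJ Kb Kc Hbc.
  suff : (set0 : set G) (b * h * c)%g by [].
  rewrite -hJ; split=> //; exists (b * h)%g; last by exists c.
  by exists b => //; exists h.
pose le (J J' : {fset G}) : Prop := (J `<=` J')%fset.
have dir : directed le.
  split; rewrite /le.
  - by constructor; exact: fset0.
  - by move=> J; exact: fsubset_refl.
  - by move=> J1 J2 J3; exact: fsubset_trans.
  - by move=> J1 J2; exists (J1 `|` J2)%fset; rewrite fsubsetUl fsubsetUr.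
exists {fset G}, le, h; split=> // [J|x y]; first by case: (hP J).
have PF := tails_filter dir.
move=> /(ominusP gK)[Mx xK] /(ominusP gK)[My yK].
have bx := vna_bounded groupT Mx.
set v := y d1 in yK *; set w := x d1 in xK *.
have [_ [k k0 xk]] := (bounded_opP x).1 bx.
apply/cvgrPdist_lt => e e0.
have eC0 : 0 < e%:C%C :> C by rewrite ltcR.
have k1 : 0 < 2 * (k + 1) :> C by rewrite mulr_gt0// ltr_wpDl.
have [J1 J1P] : exists J : {fset G},
    `|v - restr [set` J] v| < e%:C%C / (2 * (k + 1)).
  by apply: finite_approx; rewrite divr_gt0.
(* J2 is chosen after J1: the tail of w will be weighted by the coefficients of the truncated v, of
   total modulus s. Each of the two errors is allotted e / 2; adding 1 to k and to s keeps the
   denominators positive. *)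
pose s : C := \sum_(b <- J1) `|v b : C|.
have s0 : 0 <= s by apply: sumr_ge0.
have s1 : 0 < 2 * (s + 1) :> C by rewrite mulr_gt0// ltr_wpDl.
have [J2 J2P] : exists J : {fset G},
    `|w - restr [set` J] w| < e%:C%C / (2 * (s + 1)).
  by apply: finite_approx; rewrite divr_gt0.
exists (J1 `|` J2)%fset => // J /= J12.
have [Hh hJ] := hP J.
have MT : M (x \o lambda_op R (h J) \o y).
  apply: (vna_comp groupT) => //; apply: (vna_comp groupT) => //; exact: lambda_vna.
rewrite (norm2_condexp gH MT) sub0r normrN ger0_norm ?ell2_norm_ge0//.
rewrite -ltcR -ell2_normE /= -/v.
(* The 2-norm to be estimated is |T v|, and T inherits the bound k of x whatever J is. *)
pose T : op := restr H \o x \o lambda_op R (h J).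
have bT : bounded_op T.
  by do 2?apply: bounded_comp; [exact: restr_bounded|exact: bx|exact: lambda_bounded].
have Tk f : `|T f| <= k * `|f|.
  apply: le_trans (ler_restr _ _) _; apply: le_trans (xk _) _.
  by rewrite ler_wpM2l// norm_precomp//; exact: bij_mulg.
have Tdelta b : b \in J1 -> v b != 0 -> `|T (delta R b)| <= e%:C%C / (2 * (s + 1)).
  move=> bJ vb.
  have Kb : ~ K b by move=> /yK/eqP; rewrite (negbTE vb).
  (* The coordinate of x lambda_h delta_b at z in H is w a, where a = z (h b)^-1, so a h b = z is in
     H. If a is in J2 and w a is nonzero, then a and b are both in J and outside K, against the
     choice of h; so only the tail of w contributes. *)
  have -> : T (delta R b) =
      restr H (rho_op (h J * b)^-1%g (w - restr [set` J2] w)).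
    apply: ell2_ext => z.
    rewrite [LHS](_ : _ = restr H (x (delta R (h J * b)%g)) z); last first.
      by rewrite /T /= lambda_delta.
    rewrite !restrE; case: ifP => // /set_mem Hz.
    rewrite rhoE ell2BE restrE (vna_delta groupT _ _ Mx) -/w mem_setE.
    case: ifP => [aJ|_]; last by rewrite subr0.
    rewrite subrr; apply: contrapT => /eqP wa.
    apply: (hJ (z * (h J * b)^-1)%g b).
    - by apply: (fsubsetP J12); rewrite inE aJ orbT.
    - by apply: (fsubsetP J12); rewrite inE bJ.
    - by move=> /xK/eqP; rewrite (negbTE wa).
    - exact: Kb.
    - by rewrite -mulgA mulgVK.
  apply: le_trans (ler_restr _ _) _.
  by rewrite norm_precomp; [exact: ltW|exact: bij_mulgr].
change (restr H (x (lambda_op R (h J) v))) with (T v).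
have -> : T v = T (v - restr [set` J1] v) +
    \sum_(b <- J1) (v b : C) *: T (delta R b).
  have <- : T (restr [set` J1] v) = \sum_(b <- J1) (v b : C) *: T (delta R b).
    by rewrite restr_fset (bop_sum bT); apply: eq_bigr => b _; exact: (bopZ bT).
  by rewrite -(bopD bT) subrK.
have lt1 : `|T (v - restr [set` J1] v)| < e%:C%C / 2.
  apply: le_lt_trans (Tk _) _.
  apply: (@le_lt_trans _ _ (k * (e%:C%C / (2 * (k + 1))))).
    by apply: ler_wpM2l => //; exact: ltW.
  rewrite mulrA ltr_pdivrMr// (_ : _ / 2 * _ = e%:C%C * (k + 1)); last by field.
  by rewrite mulrC ltr_pM2l// ltrDl.
have le2 : `|\sum_(b <- J1) (v b : C) *: T (delta R b)| <= e%:C%C / 2.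
  apply: le_trans (ler_norm_sum _ _ _) _.
  apply: (@le_trans _ _ (s * (e%:C%C / (2 * (s + 1))))).
    rewrite {1}/s mulr_suml !big_seq; apply: ler_sum => b bJ; rewrite normrZ.
    have [->|vb] := eqVneq (v b : C) 0; first by rewrite normr0 !mul0r.
    by apply: ler_wpM2l => //; exact: Tdelta.
  rewrite mulrA ler_pdivrMr// (_ : _ / 2 * _ = e%:C%C * (s + 1)); last by field.
  by rewrite mulrC ler_pM2l// lerDl.
rewrite (splitr (e%:C%C)); apply: le_lt_trans (ler_normD _ _) _.
exact: ltr_leD.
Qed.

End OperatorImplications.

Theorem theorem1 (R : realType) (G : groupType) (H K : set G)
  (groupH : group_closed (mem H)) (groupK : group_closed (mem K))
  (subHK : H `<=` K) :
  let tau := canonical_trace R G in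
  let B := group_vna R H in
  let N := group_vna R K in
  let M := group_vna R [set: G] in
  [<-> (* (1) *)
       exists (I : Type) (le : I -> I -> Prop) (h : I -> G),
         [/\ directed le, (forall i, H (h i)) &
             forall x y, ominus tau M N x -> ominus tau M N y ->
               (fun i => norm2 tau (condexp tau M B (x \o lambda_op R (h i) \o y)))
                 @ tails le --> (0 : R)];
       (* (2) *)
       relative_wahp tau B N M;
       (* (3) *)
       quasi_normalizer1 H `<=` K;
       (* (4) *)
       compact_vectors R H `<=` supported_in R H K;
       (* (5) *)
       invariant_vectors R H `<=` supported_in R H K;
       (* (6) *)
       forall F : set G, F !=set0 -> finite_set F -> F `<=` ~` K ->
         exists h, H h /\ prodset (prodset F [set h]) F `&` H = set0].
Proof.
move=> tau B N M; tfae.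
- move=> [I [le [h [dir Hh lim]]]]; exists I, le, (fun i => lambda_op R (h i)).
  by split=> // i; exact: lambda_unitary.
- exact: quasi_normalizer_of_wahp.
- exact: compact_supported.
- by move=> c_sub xi /(invariant_compact groupH)/c_sub.
- exact: separation_of_invariant.
- exact: wahp_of_separation.
Qed.
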